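(* Let $W\in\Omega^n_{r_1,\dots,r_{k-1}}$ be a state of the $k$-species PASEP with parameters $\alpha,\beta,q$. Let $\mathrm{fil}(W)$ be the set of fillings of the maximal tiling $\mathcal T(W)$ of the $k$-rhombic diagram $\Gamma(W)$, and let $\mathrm{wt}(F)$ denote the weight of $F\in \mathrm{fil}(W)$. Put $$\mathcal Z_{n,r_1,\dots,r_{k-1}}=\sum_{W'\in\Omega^n_{r_1,\dots,r_{k-1}}}\ \sum_{F\in\mathrm{fil}(W')}\mathrm{wt}(F).$$ Then the stationary probability of the state $W$ of the $k$-species PASEP on $\Omega^n_{r_1,\dots,r_{k-1}}$ is $$\frac{1}{\mathcal Z_{n,r_1,\dots,r_{k-1}}}\sum_{F\in\mathrm{fil}(W)}\mathrm{wt}(F).$$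
   Context: **The process.** Let $k\ge1$. $\Omega^n_{r_1,\dots,r_{k-1}}$ is the set of words of length $n$ in the letters $\{d,a_1,\dots,a_{k-1},e\}$ with exactly $r_i$ letters $a_i$ for each $i$. Order the letters by heaviness: $d>a_{k-1}>\cdots>a_2>a_1>e$. The $k$-species PASEP with parameters $\alpha,\beta,q$ is the Markov chain on $\Omega^n_{r_1,\dots,r_{k-1}}$ in which, for arbitrary words $X,Y$ and letters $B>C$: $XBCY\to XCBY$ at rate $1$, $XCBY\to XBCY$ at rate $q$, $eX\to dX$ at rate $\alpha$, $Xd\to Xe$ at rate $\beta$. ''Rate $u$'' means transition probability $u/(n+1)$; with the remaining probability the chain stays in place. Here $0\le q\le1$, and $\alpha,\beta>0$ are such that outgoing probabilities sum to at most $1$. **Diagram.** Let an $e$-edge be the unit vector in direction $-\pi$ (west), a $d$-edge the unit vector in direction $-\pi/2$ (south), and an $a_i$-edge the unit vector in direction $-\frac{(2k-i)\pi}{2k}$. Let $r_0$ and $r_k$ be the numbers of $e$'s and $d$'s in $W$. $P_1(W)$ is the path obtained by placing end to end the edges corresponding to the letters of $W$, read from left to right. $P_2(W)$ is the path from the same starting (northeast) point consisting of $r_0$ $e$-edges, then $r_1$ $a_1$-edges, $r_2$ $a_2$-edges, ..., $r_{k-1}$ $a_{k-1}$-edges, then $r_k$ $d$-edges. The $k$-rhombic diagram $\Gamma(W)$ is the region enclosed between $P_1(W)$ (its southeast boundary) and $P_2(W)$ (its northwest boundary). **Tiles and maximal tiling.** For letters $B>C$, a $BC$ tile is a rhombus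 with $B$- and $C$-edges. Tiles are ordered so that $BC$ is heavier than $B'C'$ if $B>B'$, or $B=B'$ and $C>C'$. A corner of a path is a pair of consecutive edges $B,C$ with $B>C$. The maximal tiling $\mathcal T(W)$ is obtained as follows: pick a corner $BC$ of the current southeast boundary (initially $P_1(W)$) of maximal type in this order, place a $BC$ tile at that corner (so that the boundary $\cdots BC\cdots$ is replaced by $\cdots CB\cdots$), and repeat with the remaining region until the southeast boundary equals $P_2(W)$. **Strips.** An $e$-strip (resp. $d$-strip) is a maximal strip of tiles consecutively adjacent along $e$-edges (resp. $d$-edges). An $e$-strip starts at an $e$-edge of $P_1(W)$ and goes upward to $P_2(W)$; a $d$-strip starts at a $d$-edge of $P_1(W)$ and goes leftward to $P_2(W)$. ''Below'' in an $e$-strip and ''right'' in a $d$-strip mean closer to $P_1(W)$; ''above'' and ''left'' mean closer to $P_2(W)$. **Fillings.** A filling of $\mathcal T(W)$ assigns to each tile either nothing or a symbol such that: a $de$ tile is empty or contains $\alpha$ or $\beta$; a $da_i$ tile is empty or contains $\beta$; an $a_ie$ tile is empty or contains $\alpha$; an $a_ia_j$ tile ($i>j$) is empty; any tile above an $\alpha$ in the same $e$-strip is empty; any tile to the left of a $\beta$ in the same $d$-strip is empty. **Weight.** Given a filling $F$, place a $q$ in each empty tile that has neither an $\alpha$ below it in the same $e$-strip nor a $\beta$ to its right in the same $d$-strip (in particular every $a_ia_j$ tile gets a $q$). Then $\mathrm{wt}(F)$ is the product of all symbols in the tiles of $F$ times $\alpha^{t}\beta^{\ell}$, where $t$ is the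 number of $d$'s and $\ell$ the number of $e$'s in $W$. *)

(* Defs.v *)
From HB Require Import structures.
From mathcomp Require Import all_boot all_order all_algebra.
From mathcomp Require Import reals trigo.

Set Implicit Arguments.
Unset Strict Implicit.
Unset Printing Implicit Defensive.

Import Order.TTheory GRing.Theory Num.Theory.

Local Open Scope ring_scope.

(* The letters are numbered by increasing heaviness: e is 0, a_i is i for
   0 < i < k, and d is k; so B > C in heaviness is (C < B)%N. *)
Definition letter (k : nat) := 'I_k.+1.
HB.instance Definition _ k := Finite.on (letter k).

Definition ltr_e {k : nat} : letter k := ord0.
Definition ltr_d {k : nat} : letter k := ord_max.

Section Words.
Variable k : nat.
Implicit Types (w : seq (letter k)) (i : nat).

(* Positions start at 0; this turns XBCY into XCBY, where size X = i. *)
Definition swap_at w i : seq (letter k) :=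
  take i w ++ [:: nth ltr_e w i.+1; nth ltr_e w i] ++ drop i.+2 w.

Definition is_corner w i : bool :=
  (i.+1 < size w)%N && (nth ltr_e w i.+1 < nth ltr_e w i)%N.

(* (B, C) stands for the tile type BC, with B > C. *)
Definition corner_type w i : letter k * letter k :=
  (nth ltr_e w i, nth ltr_e w i.+1).

Definition heavier_type (t t' : letter k * letter k) : bool :=
  (t'.1 < t.1)%N || ((t.1 == t'.1) && (t'.2 < t.2)%N).

Definition is_max_corner w i : Prop :=
  is_corner w i /\
  forall j, is_corner w j -> ~~ heavier_type (corner_type w j) (corner_type w i).

(* The word read along P_2. *)
Definition northwest_word w : seq (letter k) :=
  flatten [seq nseq (count_mem a w) a | a <- enum 'I_k.+1].

End Words.

(* Omega^n_{r_1, ..., r_{k-1}}; only the values r i with 0 < i < k matter. *)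
Definition omega (k n : nat) (r : nat -> nat) : finType :=
  {w : n.-tuple (letter k) |
    [forall a : letter k, (0 < a < k)%N ==> (count_mem a w == r a)]}.

Definition word_of (k n : nat) (r : nat -> nat) (X : omega k n r) :
  seq (letter k) := val (val X).

Section Chain.
Variables (R : realType) (k : nat) (alpha beta q : R).
Implicit Types (v w : seq (letter k)).

Definition swap_rate (B C : letter k) : R :=
  if (C < B)%N then 1 else if (B < C)%N then q else 0.

Definition rate v w : R :=
  \sum_(i < (size v).-1 | w == swap_at v i)
     swap_rate (nth ltr_e v i) (nth ltr_e v i.+1)
  + (if (v == ltr_e :: behead v) && (w == ltr_d :: behead v)
     then alpha else 0)
  + (let u := take (size v).-1 v in
     if (v == rcons u ltr_d) && (w == rcons u ltr_e) then beta else 0).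

Variables (n : nat) (r : nat -> nat).
Implicit Types X Y : omega k n r.

Definition outgoing X : R :=
  \sum_(Y | Y != X) rate (word_of X) (word_of Y) / n.+1%:R.

Definition transition X Y : R :=
  if Y == X then 1 - outgoing X
  else rate (word_of X) (word_of Y) / n.+1%:R.

Definition stationary (p : {ffun omega k n r -> R}) : Prop :=
  [/\ forall X, 0 <= p X,
      \sum_X p X = 1
    & forall Y, \sum_X p X * transition X Y = p Y].

End Chain.

Section Tilings.
Variables (R : realType) (k : nat).

(* (p, (B, C)) is the rhombus with vertices p, p + B, p + C and p + B + C,
   B and C also denoting the edge vectors. Edge directions lie between west and
   south, so p is where its southeast boundary (B, then C) and its northwest
   boundary (C, then B) both start. *)
Definition tile : Type := ((R * R) * (letter k * letter k))%type.
HB.instance Definition _ := Choice.on tile.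

Definition edge (a : letter k) : R * R :=
  let theta : R := - ((2 * k - a)%:R * pi / (2 * k)%:R) in
  (cos theta, sin theta).

(* All paths start at the origin. *)
Definition path_vertex (w : seq (letter k)) (i : nat) : R * R :=
  \sum_(a <- take i w) edge a.

Definition corner_tile (w : seq (letter k)) (i : nat) : tile :=
  (path_vertex w i, corner_type w i).

(* maximal_tiling w T: the list T of tiles can be placed, in this order, by the
   maximal tiling procedure when the current southeast boundary reads w. *)
Inductive maximal_tiling : seq (letter k) -> seq tile -> Prop :=
| MaxTilingDone w : w = northwest_word w -> maximal_tiling w [::]
| MaxTilingStep w i T : w <> northwest_word w -> is_max_corner w i ->
    maximal_tiling (swap_at w i) T ->
    maximal_tiling w (corner_tile w i :: T).

(* The northwest e-edge of the Be tile t is the southeast e-edge of the B'e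
   tile t'. *)
Definition next_above (t t' : tile) : bool :=
  [&& t.2.2 == ltr_e, t'.2.2 == ltr_e & t.1 == t'.1 + edge t'.2.1].

(* The northwest d-edge of the dC tile t is the southeast d-edge of the dC'
   tile t'. *)
Definition next_left (t t' : tile) : bool :=
  [&& t.2.1 == ltr_d, t'.2.1 == ltr_d & t.1 + edge t.2.2 == t'.1].

Variable T : seq tile.
Implicit Types t : seq_sub T.

(* t' is strictly above t in the same e-strip. *)
Definition above t t' : bool :=
  [exists u : seq_sub T, next_above (val t) (val u) &&
    connect (fun x y : seq_sub T => next_above (val x) (val y)) u t'].

(* t' is strictly to the left of t in the same d-strip. *)
Definition left_of t t' : bool :=
  [exists u : seq_sub T, next_left (val t) (val u) &&
    connect (fun x y : seq_sub T => next_left (val x) (val y)) u t'].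

End Tilings.

Variant content := Empty | Alpha | Beta.

Definition content_code (c : content) : option bool :=
  match c with Empty => None | Alpha => Some true | Beta => Some false end.
Definition content_decode (o : option bool) : content :=
  match o with None => Empty | Some b => if b then Alpha else Beta end.
Lemma content_codeK : cancel content_code content_decode.
Proof. by case. Qed.
HB.instance Definition _ := Finite.copy content (can_type content_codeK).

Section Fillings.
Variables (R : realType) (k : nat) (alpha beta q : R).
Variable T : seq (tile R k).
Implicit Types F : {ffun seq_sub T -> content}.

(* Allowed contents of a tile of type BC. *)
Definition allowed (BC : letter k * letter k) (c : content) : bool :=
  match c with
  | Empty => true
  | Alpha => BC.2 == ltr_e
  | Beta => BC.1 == ltr_d
  end.

Definition alpha_below F (t : seq_sub T) : bool :=
  [exists u, (F u == Alpha) && above u t].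

Definition beta_right F (t : seq_sub T) : bool :=
  [exists u, (F u == Beta) && left_of u t].

Definition fil : {set {ffun seq_sub T -> content}} :=
  [set F : {ffun seq_sub T -> content} | [forall t : seq_sub T,
     allowed (val t).2 (F t) &&
     (alpha_below F t || beta_right F t ==> (F t == Empty))]].

Definition tile_weight F (t : seq_sub T) : R :=
  match F t with
  | Alpha => alpha
  | Beta => beta
  | Empty => if alpha_below F t || beta_right F t then 1 else q
  end.

Definition wt (w : seq (letter k)) F : R :=
  (\prod_t tile_weight F t)
  * alpha ^+ count_mem ltr_d w * beta ^+ count_mem ltr_e w.

End Fillings.

(* The maximal tiling procedure always terminates in the word of P_2. *)
Section Existence.
Variables (R : realType) (k : nat).
Implicit Types w : seq (letter k).

Lemma swap_atE w i : (i.+1 < size w)%N ->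
  w = take i w ++ [:: nth ltr_e w i; nth ltr_e w i.+1] ++ drop i.+2 w.
Proof.
move=> hi; rewrite -{1}(cat_take_drop i w) (drop_nth ltr_e) ?(ltnW hi) //.
by rewrite (drop_nth ltr_e hi).
Qed.

Lemma perm_swap_at w i : (i.+1 < size w)%N -> perm_eq (swap_at w i) w.
Proof.
move=> hi; rewrite {2}(swap_atE hi) perm_cat2l perm_cat2r.
by apply/permP => P /=; rewrite addnCA.
Qed.

Fixpoint potential w : nat :=
  if w is a :: s then (a * size s + potential s)%N else 0%N.

Lemma potential_swap_at w i :
  is_corner w i -> (potential (swap_at w i) < potential w)%N.
Proof.
move=> /andP[hi hlt]; rewrite {2}(swap_atE hi) /swap_at.
move: (nth _ _ _) (nth _ _ _) (take _ _) (drop _ _) hlt => B C u v hlt.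
elim: u => [|a u IH] /=; last by rewrite !size_cat /= ltn_add2l.
by rewrite !mulnS !addnA ltn_add2r -!addnA (addnC (B * _)%N) ltn_add2r.
Qed.

Lemma perm_northwest_word w : perm_eq (northwest_word w) w.
Proof.
apply/allP => a _ /=; apply/eqP; rewrite count_flatten -map_comp.
rewrite (eq_map (g := fun b => ((b == a) * count_mem a w)%N)); last first.
  by move=> b /=; rewrite count_nseq /=; case: eqP => [->|].
rewrite sumnE big_map big_enum /= (bigD1 a) //= eqxx mul1n big1 ?addn0 //.
by move=> b /negPf ->.
Qed.

Lemma sorted_northwest_word w :
  sorted (fun a b : letter k => (a <= b)%N) (northwest_word w).
Proof.
have tr : transitive (fun a b : letter k => (a <= b)%N).
  by move=> b a c; exact: leq_trans.
have: pairwise (fun a b : letter k => (a < b)%N) (enum 'I_k.+1).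
  rewrite -sorted_pairwise; last by move=> b a c; exact: ltn_trans.
  by have := iota_ltn_sorted 0 k.+1; rewrite -val_enum_ord sorted_map.
rewrite sorted_pairwise // /northwest_word.
elim: (enum _) => //= a s IH /andP[/allP ha /IH hs].
rewrite pairwise_cat hs andbT; apply/andP; split.
  apply/allrelP => x y; rewrite mem_nseq => /andP[_ /eqP ->].
  move=> /flattenP[t /mapP[b /ha hab ->]]; rewrite mem_nseq => /andP[_ /eqP ->].
  exact: ltnW.
by elim: (count_mem a w) => //= m ->; rewrite andbT all_nseq leqnn orbT.
Qed.

Lemma northwest_wordP w :
  (forall i, ~~ is_corner w i) -> w = northwest_word w.
Proof.
move=> h; apply: (@sorted_eq _ (fun a b : letter k => (a <= b)%N)).
- by move=> b a c; exact: leq_trans.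
- by move=> a b; rewrite -eqn_leq => /eqP /val_inj.
- apply/(sortedP ltr_e) => i hi.
  by move: (h i); rewrite /is_corner hi /= -leqNgt.
- exact: sorted_northwest_word.
- by rewrite perm_sym perm_northwest_word.
Qed.

Lemma exists_max_corner w i : is_corner w i -> exists j, is_max_corner w j.
Proof.
move=> hi; have lt_i : (i < size w)%N by case/andP: hi => /ltnW.
pose code (j : 'I_(size w)) :=
  (nth ltr_e w j * k.+1 + nth ltr_e w j.+1)%N.
case: (arg_maxnP (P := fun j : 'I_(size w) => is_corner w j) code
         (i0 := Ordinal lt_i) hi) => j hj hmax.
exists j; split=> // l hl; have lt_l : (l < size w)%N by case/andP: hl => /ltnW.
have: (code (Ordinal lt_l) <= code j)%N := hmax (Ordinal lt_l) hl.
rewrite leqNgt; apply: contra.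
rewrite /heavier_type /code /=; case/orP => [lt1|/andP[/eqP <- lt2]].
  apply: (leq_trans (n := ((nth ltr_e w j).+1 * k.+1)%N)).
    by rewrite mulSn addnC ltn_add2r.
  by rewrite (leq_trans _ (leq_addr _ _)) // leq_mul2r lt1 orbT.
by rewrite ltn_add2l.
Qed.

Lemma maximal_tiling_exists w : exists T : seq (tile R k), maximal_tiling w T.
Proof.
have [m] := ubnP (potential w); elim: m w => // m IH w hm.
have [hw|hw] := eqVneq w (northwest_word w); first by exists [::]; constructor.
have [i hi] : exists i, is_max_corner w i.
  have /hasP[i _ /exists_max_corner//] : has (is_corner w) (iota 0 (size w)).
  apply: contraNT hw => /hasPn h; apply/eqP/northwest_wordP => i.
  apply/negP => hi; have /andP[/ltnW lt_i _] := hi.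
  by move: (h i); rewrite mem_iota hi lt_i => /(_ isT).
have lt_m : (potential (swap_at w i) < m)%N.
  exact: leq_trans (potential_swap_at hi.1) hm.
have [T hT] := IH _ lt_m.
by exists (corner_tile R w i :: T); constructor=> //; apply/eqP.
Qed.

End Existence.

(* Main.v *)
Require Import Defs.
From HB Require Import structures.
From mathcomp Require Import all_boot all_order all_algebra.
From mathcomp Require Import ring lra zify.
From mathcomp Require Import reals trigo.

Set Implicit Arguments.
Unset Strict Implicit.
Unset Printing Implicit Defensive.

Import Order.TTheory GRing.Theory Num.Theory.

Local Open Scope ring_scope.

(** The proof is a matrix ansatz. With c = alpha * beta, the generating function
    of the fillings turns out to be a function f of words such that, for B > C,
      f(X B C Y) = q f(X C B Y) + c [C = e] f(X B Y) + c [B = d] f(X C Y),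
      f(e Y) = beta f(Y),    f(X d) = alpha f(X),
    and f(w) = alpha^#d beta^#e when w is sorted. Two things are proved about
    such an f: it is stationary, and it counts fillings.

    Stationarity ([balance]): by the first relation the net probability flux
    through positions i, i+1 of a word y is h(y_i) f(y without y_i) -
    h(y_{i+1}) f(y without y_{i+1}), where h(e) = c, h(d) = - c and h(a_i) = 0
    ([swap_flux]). The sum over i telescopes, and by the two boundary relations
    the entrance and exit rates cancel the two terms that remain.

    Existence of f: the relations could contradict each other, since a word can
    be sorted in many orders. So f is constructed, from a representation on
    polynomials: the letter e multiplies by 'X, a middle letter substitutes
    q 'X + c for 'X, d acts by a twisted derivation, and f is the value at beta
    ([word_weight], [word_weight_corner]).

    Fillings ([sum_wt_tiling]): fill the tiles in the order in which they are
    placed. An alpha, resp. a beta, makes the rest of its e-strip, resp. d-strip,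
    empty with weight 1, which amounts to erasing from the word the letter that
    carries the strip. So placing a BC tile expands the generating function
    exactly as the first relation expands f: its three terms are the empty tile,
    the alpha and the beta ([scan_sum_word_weight]). Since the relation holds at
    every corner, the order in which the tiling is built does not matter.

    That argument needs the strips, which are defined by the positions of the
    tiles in the plane, to be the trajectories of single letters of the word
    ([aboveE], [left_ofE]). If two boundary paths reached during the construction
    have vertices at the same point, the letters read before it are the same:
    otherwise every letter read only before the vertex of the earlier path would
    be heavier than every letter read only before that of the later one, so two
    sums of edges in disjoint cones, not both empty, would be equal ([vsum_inj],
    [same_vertex]).

    Uniqueness ([stationary_unique]): the positive and the negative part of a
    difference of two stationary distributions are both invariant, and each would
    charge the sorted word without d, which can be reached from every state. *)

(** * Weights of words from a representation on polynomials *)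

Section TwistedDerivation.
Variables (R : comNzRingType) (q c : R).
Implicit Types p : {poly R}.

(** The image of e when a middle letter moves past it: a e = (q e + c) a. *)
Definition affine : {poly R} := q%:P * 'X + c%:P.

Definition twist p : {poly R} := p \Po affine.

(** [p |-> [[twist p, tder p], [0, p]]] is the ring morphism that sends 'X to
    this matrix; multiplicativity of the morphism is the twisted Leibniz rule
    tder (p1 p2) = twist p1 * tder p2 + tder p1 * p2. *)
Definition tder_mx : 'M[{poly R}]_2 :=
  \matrix_(i, j) if j == 0 then (i == 0)%:R * affine
                 else if i == 0 then c%:P * 'X else 'X.

Definition tder p : {poly R} := horner_mx tder_mx (map_poly polyC p) 0 1.

Lemma twistC a : twist a%:P = a%:P. Proof. exact: comp_polyC. Qed.
Lemma twistX : twist 'X = affine. Proof. exact: comp_polyX. Qed.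
Lemma twistD p1 p2 : twist (p1 + p2) = twist p1 + twist p2.
Proof. exact: comp_polyD. Qed.
Lemma twistM p1 p2 : twist (p1 * p2) = twist p1 * twist p2.
Proof. exact: comp_polyM. Qed.

Lemma tderD p1 p2 : tder (p1 + p2) = tder p1 + tder p2.
Proof. by rewrite /tder !rmorphD mxE. Qed.

Lemma tderC a : tder a%:P = 0.
Proof. by rewrite /tder map_polyC horner_mx_C mxE. Qed.

Lemma tderCM a p : tder (a%:P * p) = a%:P * tder p.
Proof.
by rewrite /tder !rmorphM /= map_polyC horner_mx_C /= -mulmxE mul_scalar_mx mxE.
Qed.

Lemma tder_mx11 p : horner_mx tder_mx (map_poly polyC p) 1 1 = p.
Proof.
suff [] : horner_mx tder_mx (map_poly polyC p) 1 1 = p /\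
          horner_mx tder_mx (map_poly polyC p) 1 0 = 0 by [].
elim/poly_ind: p => [|p a [IH1 IH0]].
  by rewrite !rmorph0 !mxE.
rewrite !rmorphD !rmorphM /= map_polyX map_polyC horner_mx_X horner_mx_C /=.
rewrite !mxE !big_ord_recl !big_ord0 !mxE /=.
have -> : lift ord0 ord0 = 1 :> 'I_2 by apply: val_inj.
by rewrite IH1 IH0 /= !(mul0r, mulr0, mulr0n, add0r, addr0).
Qed.

Lemma tderXM p : tder ('X * p) = affine * tder p + c%:P * 'X * p.
Proof.
rewrite /tder !rmorphM /= map_polyX horner_mx_X mxE !big_ord_recl big_ord0.
have -> : lift ord0 ord0 = 1 :> 'I_2 by apply: val_inj.
by rewrite tder_mx11 !mxE /= mul1r addr0.
Qed.

(** This is what the relation d a = q a d + c a demands of the operators. *)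
Lemma tder_twist p :
  tder (twist p) =
  q%:P * twist (tder p) + c%:P * twist p - c%:P * twist (twist p).
Proof.
elim/poly_ind: p => [|p a IH]; first by rewrite -[0]polyC0 !(twistC, tderC); ring.
rewrite [p * 'X]mulrC !(tderD, twistD, twistM, twistX, twistC, tderC, tderXM).
have -> : tder (affine * twist p) =
    (q%:P * affine + c%:P) * tder (twist p) + q%:P * c%:P * 'X * twist p.
  rewrite {1}/affine mulrDl tderD -mulrA !tderCM tderXM; ring.
by rewrite IH /affine polyC0; ring.
Qed.

End TwistedDerivation.

Section WordPolynomial.
Variables (R : comNzRingType) (k : nat) (alpha beta q : R).
Hypothesis k_gt0 : (0 < k)%N.
Implicit Types (w X Y : seq (letter k)) (a B C : letter k).

Let c := alpha * beta.

(** The scalar by which d acts on the right of all the e's, on m middle letters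
    followed by the right end of the word: d a^m = (q^m d + c [m]_q) a^m, with d
    acting as alpha at the end. *)
Fixpoint d_scalar (m : nat) : R := if m is m'.+1 then q * d_scalar m' + c else alpha.

(** For b = k these are the middle letters, for a middle letter b those that
    are lighter than b. *)
Definition mid_letter (b : nat) a := (0 < a < b)%N.

(** Left action of a letter on a word whose letters other than e have been moved
    to the right: p is the polynomial in e that is left, and cnt counts middle
    letters as in [mid_letter]. The power of q makes a_i a_j = q a_j a_i for i > j. *)
Definition letter_act a (cnt : nat -> nat) (p : {poly R}) : {poly R} :=
  if a == ltr_e then 'X * p
  else if a == ltr_d then (d_scalar (cnt k))%:P * twist q c p + tder q c p
  else (q ^+ cnt a)%:P * twist q c p.

Fixpoint word_poly w : {poly R} :=
  if w is a :: w' then letter_act a (fun b =>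
    count (mid_letter b) w') (word_poly w') else 1.

Definition word_weight w : R := (word_poly w).[beta].

Lemma d_neq_e : (ltr_d == ltr_e :> letter k) = false.
Proof. by apply/negbTE; rewrite -val_eqE /= -lt0n. Qed.

Lemma mid_letter_e b : mid_letter b ltr_e = false. Proof. by []. Qed.
Lemma mid_letter_d b : (b <= k)%N -> mid_letter b ltr_d = false.
Proof. by rewrite /mid_letter /= => h; rewrite [(k < b)%N]ltnNge h andbF. Qed.

Lemma letter_leq a : (a <= k)%N. Proof. by rewrite -ltnS. Qed.

Lemma letter_actD a cnt p1 p2 : letter_act a cnt (p1 + p2) = letter_act a cnt p1
  + letter_act a cnt p2.
Proof. by rewrite /letter_act; do 2?case: ifP => _; rewrite 1?twistD 1?tderD;
  ring. Qed.

Lemma letter_actZ a cnt b p : letter_act a cnt (b%:P * p) = b%:P * letter_act a cnt p.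
Proof.
by rewrite /letter_act; do 2?case: ifP => _; rewrite 1?twistM 1?twistC 1?tderCM; ring.
Qed.

Lemma eq_letter_act a cnt cnt' p :
  (forall b, (b <= k)%N -> cnt b = cnt' b) -> letter_act a cnt p
    = letter_act a cnt' p.
Proof. by move=> h; rewrite /letter_act (h k) // (h a) ?letter_leq. Qed.

Definition corner_coef (b : bool) : {poly R} := (b%:R * c)%:P.

(** Each case is one relation of the algebra: d e = q e d + c (d + e),
    a e = q e a + c a, d a = q a d + c a, a_i a_j = q a_j a_i. *)
Lemma word_poly_corner B C Y : (C < B)%N ->
  word_poly [:: B, C & Y] = q%:P * word_poly [:: C, B & Y]
    + corner_coef (C == ltr_e) * word_poly (B :: Y)
    + corner_coef (B == ltr_d) * word_poly (C :: Y).
Proof.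
move=> ltCB; have Bne : (B == ltr_e) = false.
  by rewrite -val_eqE /=; case: (val B) ltCB.
have Cnd : (C == ltr_d) = false.
  by rewrite -val_eqE /= ltn_eqF // (leq_trans ltCB) // letter_leq.
rewrite /= /corner_coef /letter_act Bne Cnd.
case: (eqVneq C ltr_e) => [eC|Cne]; case: (eqVneq B ltr_d) => [eB|Bnd] /=;
  rewrite ?eC ?eB ?mid_letter_e ?mid_letter_d ?letter_leq // ?add0n ?add1n ?mul1r
    ?mul0r ?polyC0 ?mul0r ?addr0.
- by rewrite tderXM twistM twistX /affine; ring.
- by rewrite twistM twistX /affine; ring.
- have -> : mid_letter k C.
    by rewrite /mid_letter (leq_trans ltCB (letter_leq _)) andbT lt0n.
  rewrite add1n /= !polyCD !polyCM.
  rewrite !(twistD, twistM, twistC) tderCM tder_twist /c polyCM; ring.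
- have -> : mid_letter B C by rewrite /mid_letter ltCB andbT lt0n.
  have -> : mid_letter C B = false by rewrite /mid_letter [(B < C)%N]ltnNge (ltnW
    ltCB) andbF.
  by rewrite add1n add0n exprS !twistM !twistC !polyCM; ring.
Qed.

(** The letters of X act on the three words Y that follow them through the same
    operators, because the words have the same numbers of middle letters
    whenever their coefficients are nonzero. *)
Lemma word_poly_corner_in X B C Y : (C < B)%N ->
  word_poly (X ++ [:: B, C & Y]) = q%:P * word_poly (X ++ [:: C, B & Y])
    + corner_coef (C == ltr_e) * word_poly (X ++ B :: Y)
    + corner_coef (B == ltr_d) * word_poly (X ++ C :: Y).
Proof.
move=> ltCB; elim: X => [|a X IH]; first exact: word_poly_corner.
rewrite /= IH !letter_actD !letter_actZ; congr (_ + _ + _).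
- by congr (_ * _); apply: eq_letter_act => b hb;
  rewrite !count_cat /= (addnCA (mid_letter b B)).
- case: eqP => [->|_]; last by rewrite /corner_coef mul0r polyC0 !mul0r.
  by congr (_ * _); apply: eq_letter_act => b hb; rewrite !count_cat /= ?mid_letter_e.
- case: eqP => [->|_]; last by rewrite /corner_coef mul0r polyC0 !mul0r.
  by congr (_ * _); apply: eq_letter_act => b hb; rewrite !count_cat /= ?mid_letter_d.
Qed.

Lemma word_weight_corner X B C Y : (C < B)%N ->
  word_weight (X ++ [:: B, C & Y]) = q * word_weight (X ++ [:: C, B & Y])
    + (C == ltr_e)%:R * c * word_weight (X ++ B :: Y)
    + (B == ltr_d)%:R * c * word_weight (X ++ C :: Y).
Proof.
by move=> h; rewrite /word_weight word_poly_corner_in // /corner_coef !hornerE.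
Qed.

Lemma word_weight_e Y : word_weight (ltr_e :: Y) = beta * word_weight Y.
Proof. by rewrite /word_weight /= /letter_act eqxx !hornerE. Qed.

(** A last letter d only scales the vector on which the others act. *)
Lemma word_weight_d X : word_weight (rcons X ltr_d) = alpha * word_weight X.
Proof.
suff -> : word_weight (rcons X ltr_d) = (alpha%:P * word_poly X).[beta].
  by rewrite !hornerE.
congr horner; elim: X => [|a X IH] /=.
  rewrite /letter_act d_neq_e eqxx /= -[1]polyC1 twistC tderC; ring.
rewrite IH letter_actZ; congr (_ * _); apply: eq_letter_act => b hb.
by rewrite -cats1 count_cat /= mid_letter_d // !addn0.
Qed.

Lemma word_weight_sorted w : sorted (fun a b : letter k => (a <= b)%N) w ->
  word_weight w = alpha ^+ count_mem ltr_d w * beta ^+ count_mem ltr_e w.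
Proof.
elim: w => [|a w IH] /=; first by rewrite /word_weight hornerC !expr0 mulr1.
move=> pth; have srt := path_sorted pth.
have /allP amin : all (fun b : letter k => (a <= b)%N) w.
  by apply: order_path_min pth => x y z; apply: leq_trans.
case: (eqVneq a ltr_e) => [->|ane].
  by rewrite word_weight_e IH // eq_sym d_neq_e add0n add1n exprS; ring.
have noe : count_mem ltr_e (a :: w) = 0%N.
  apply/count_memPn/negP; rewrite inE eq_sym (negbTE ane) /= => /amin.
  by rewrite leqn0 => h; case/negP: ane; rewrite -val_eqE.
move/eqP: noe; rewrite /= addn_eq0 => /andP[_ /eqP ->]; rewrite add0n expr0 mulr1.
suff: word_poly (a :: w) = (alpha ^+ ((a == ltr_d) + count_mem ltr_d w))%:P.
  by rewrite /word_weight => ->; rewrite hornerC.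
have {srt} : forall v, sorted (fun a b : letter k => (a <= b)%N) v ->
   ltr_e \notin v -> word_poly v = (alpha ^+ count_mem ltr_d v)%:P; last first.
  move=> h; rewrite h //= inE eq_sym negb_or ane; apply/negP => /amin.
  by rewrite leqn0 => h'; case/negP: ane; rewrite -val_eqE.
elim=> [|x v IHv] //= pthv; rewrite inE negb_or eq_sym => /andP[xe ve].
rewrite IHv ?(path_sorted pthv) // /letter_act (negbTE xe) twistC tderC addr0 -polyCM.
have /allP xmin : all (fun b : letter k => (x <= b)%N) v.
  by apply: order_path_min pthv => s y z; apply: leq_trans.
have cnt0 b : (b <= x)%N -> count (mid_letter b) v = 0%N.
  move=> hb; apply/eqP; rewrite -leqn0 leqNgt -has_count; apply/hasPn => y /xmin.
  by move=> h; rewrite /mid_letter negb_and -!leqNgt (leq_trans hb h) orbT.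
case: eqP => [xd|_]; last by rewrite cnt0 // expr0 mul1r.
by rewrite cnt0 ?xd //= exprS.
Qed.

End WordPolynomial.

(** * Stationarity of the weights *)

Section OmegaWords.
Variables (k n : nat) (r : nat -> nat).
Implicit Types (w y : seq (letter k)) (X Y : omega k n r).

Definition in_omega w : bool :=
  (size w == n) &&
  [forall a : letter k, (0 < a < k)%N ==> (count_mem a w == r a)].

Lemma word_of_in X : in_omega (word_of X).
Proof. by rewrite /in_omega /word_of size_tuple eqxx (valP X). Qed.

Lemma size_word X : size (word_of X) = n.
Proof. exact: size_tuple. Qed.

Lemma word_of_inj : injective (@word_of k n r).
Proof. by move=> X Y e; apply/val_inj/val_inj. Qed.

Lemma in_omegaP w : in_omega w -> exists X : omega k n r, word_of X = w.
Proof.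
case/andP=> sz cnt; pose t : n.-tuple (letter k) := Tuple sz.
by exists (Sub t cnt : omega k n r); rewrite /word_of SubK.
Qed.

Lemma in_omega_perm w w' : perm_eq w w' -> in_omega w -> in_omega w'.
Proof.
move=> pw /andP[sz /forallP cnt]; rewrite /in_omega -(perm_size pw) sz.
by apply/forallP => a; rewrite -(permP pw).
Qed.

Lemma in_omega_swap w i : (i.+1 < size w)%N -> in_omega w -> in_omega (swap_at w i).
Proof. by move=> h; apply: in_omega_perm; rewrite perm_sym perm_swap_at. Qed.

Lemma in_omega_end w u (a b : letter k) :
  perm_eq w (a :: u) -> ~~ (0 < a < k)%N -> ~~ (0 < b < k)%N ->
  in_omega w -> in_omega (b :: u).
Proof.
move=> pw na nb /(in_omega_perm pw) /andP[sz /forallP cnt].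
rewrite /in_omega [size _]/= sz; apply/forallP => x; apply/implyP => hx.
move: (implyP (cnt x) hx) => /=.
have -> : (a == x) = false by apply: contraNF na => /eqP ->.
by have -> : (b == x) = false by apply: contraNF nb => /eqP ->.
Qed.

(** Restores a sum over states from the single word that contributes to it. *)
Lemma sum_omega (R : nmodType) (g : seq (letter k) -> R) w : in_omega w ->
  \sum_(X : omega k n r) (if word_of X == w then g (word_of X) else 0) = g w.
Proof.
case/in_omegaP => X0 <-; rewrite (bigD1 X0) //= eqxx big1 ?addr0 // => X nX.
by rewrite (inj_eq word_of_inj) (negbTE nX).
Qed.

Lemma swap_cat (P S : seq (letter k)) a b i : size P = i ->
  swap_at (P ++ [:: a, b & S]) i = P ++ [:: b, a & S].
Proof.
move=> <-; rewrite /swap_at take_size_cat // !nth_cat ltnn subnn ltnNge leqnSn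
  subSnn /=.
by rewrite drop_cat ltnNge -addn2 leq_addr addKn /= ?drop0.
Qed.

Lemma swap_atK w i : (i.+1 < size w)%N -> swap_at (swap_at w i) i = w.
Proof.
move=> h; have sz : size (take i w) = i by rewrite size_take ltnW // ltnW.
by rewrite [swap_at w i]/swap_at swap_cat //; apply/esym/swap_atE.
Qed.

End OmegaWords.

Section Balance.
Variables (R : realType) (k n : nat) (r : nat -> nat) (alpha beta q : R).
Hypothesis k_gt0 : (0 < k)%N.
Implicit Types (w y : seq (letter k)) (X Y : omega k n r).
Local Notation value := (word_weight alpha beta q).
Local Notation c := (alpha * beta).

(** The hat vector of the ansatz; here it is a vector of scalars. *)
Definition hat (a : letter k) : R :=
  (a == ltr_e)%:R * c - (a == ltr_d)%:R * c.

(** The corner relation, read as a statement on the flux between two neighbours. *)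
Lemma exchange_flux (P S : seq (letter k)) (a b : letter k) :
  swap_rate q b a * value (P ++ [:: b, a & S])
  - swap_rate q a b * value (P ++ [:: a, b & S])
  = hat a * value (P ++ b :: S) - hat b * value (P ++ a :: S).
Proof.
rewrite /swap_rate /hat; case: (ltngtP a b) => [lt|lt|/val_inj ->].
- rewrite (word_weight_corner alpha beta q P S lt).
  have -> : (b == ltr_e) = false by apply: contraTF lt => /eqP ->.
  have -> : (a == ltr_d) = false.
    by apply: contraTF lt => /eqP ->; rewrite -leqNgt letter_leq.
  by rewrite /= ?mul0r; ring.
- rewrite (word_weight_corner alpha beta q P S lt).
  have -> : (a == ltr_e) = false by apply: contraTF lt => /eqP ->.
  have -> : (b == ltr_d) = false.
    by apply: contraTF lt => /eqP ->; rewrite -leqNgt letter_leq.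
  by rewrite /= ?mul0r; ring.
- by ring.
Qed.

Definition drop_at w i := take i w ++ drop i.+1 w.

Lemma swap_flux y i : (i.+1 < size y)%N ->
  swap_rate q (nth ltr_e y i.+1) (nth ltr_e y i) * value (swap_at y i)
  - swap_rate q (nth ltr_e y i) (nth ltr_e y i.+1) * value y
  = hat (nth ltr_e y i) * value (drop_at y i)
    - hat (nth ltr_e y i.+1) * value (drop_at y i.+1).
Proof.
move=> h; have ey : take i y ++ [:: nth ltr_e y i,
  nth ltr_e y i.+1 & drop i.+2 y] = y.
  exact/esym/swap_atE.
have := exchange_flux (take i y) (drop i.+2 y) (nth ltr_e y i) (nth ltr_e y i.+1).
rewrite ey => fl; apply: etrans fl _; rewrite /drop_at.
rewrite (take_nth ltr_e (ltnW h)) cat_rcons.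
by rewrite (drop_nth ltr_e h).
Qed.

Lemma sum_exchange y : in_omega n r y ->
  \sum_(X : omega k n r) value (word_of X) *
     (\sum_(i < (size (word_of X)).-1 | y == swap_at (word_of X) i)
        swap_rate q (nth ltr_e (word_of X) i) (nth ltr_e (word_of X) i.+1))
  = \sum_(0 <= i < n.-1)
       swap_rate q (nth ltr_e y i.+1) (nth ltr_e y i) * value (swap_at y i).
Proof.
move=> hy; have sy : size y = n by case/andP: hy => /eqP.
transitivity (\sum_(X : omega k n r) \sum_(0 <= i < n.-1)
   (if word_of X == swap_at y i then
      swap_rate q (nth ltr_e (word_of X) i) (nth ltr_e (word_of X) i.+1)
        * value (word_of X) else 0)).
  apply: eq_bigr => X _; rewrite -(big_mkord (fun i => y == swap_at (word_of X) i)
    (fun i => swap_rate q (nth ltr_e (word_of X) i) (nth ltr_e (word_of X) i.+1))).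
  rewrite size_word big_mkcond big_distrr /= !big_nat; apply: eq_bigr => i hi.
  have hi' : (i.+1 < n)%N by lia.
  have -> : (y == swap_at (word_of X) i) = (word_of X == swap_at y i).
    by apply/eqP/eqP => ->; rewrite swap_atK ?sy ?size_word.
  by case: eqP => _; rewrite ?mulr0 // mulrC.
rewrite exchange_big /= !big_nat; apply: eq_bigr => i hi.
have hi' : (i.+1 < size y)%N by lia.
rewrite (sum_omega (fun w => swap_rate q (nth ltr_e w i) (nth ltr_e w i.+1) * value
  w));
  last exact: in_omega_swap.
have sz : size (take i y) = i by rewrite size_take ltnW // ltnW.
have -> : nth ltr_e (swap_at y i) i = nth ltr_e y i.+1.
  by rewrite /swap_at nth_cat sz ltnn subnn.
suff -> : nth ltr_e (swap_at y i) i.+1 = nth ltr_e y i by [].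
by rewrite /swap_at nth_cat sz ltnNge leqnSn subSnn.
Qed.

Lemma sum_exchange_out y : in_omega n r y ->
  \sum_(X : omega k n r)
     (\sum_(i < (size y).-1 | word_of X == swap_at y i)
        swap_rate q (nth ltr_e y i) (nth ltr_e y i.+1))
  = \sum_(0 <= i < n.-1) swap_rate q (nth ltr_e y i) (nth ltr_e y i.+1).
Proof.
move=> hy; have sy : size y = n by case/andP: hy => /eqP.
transitivity (\sum_(X : omega k n r) \sum_(0 <= i < n.-1)
   (if word_of X == swap_at y i then
      swap_rate q (nth ltr_e y i) (nth ltr_e y i.+1) else 0)).
  by apply: eq_bigr => X _; rewrite -big_mkcond big_mkord sy.
rewrite exchange_big /= !big_nat; apply: eq_bigr => i hi.
rewrite (sum_omega (fun=> swap_rate q (nth ltr_e y i) (nth ltr_e y i.+1))) //.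
by apply: in_omega_swap => //; lia.
Qed.

(** Inflow equals outflow. Transitions from a state to itself contribute to both
    sides alike, so they are kept in the sums. *)
Lemma balance Y :
  \sum_(X : omega k n r) value (word_of X) * rate alpha beta q (word_of X) (word_of Y)
  = value (word_of Y) * \sum_(X : omega k n r) rate alpha beta q (word_of Y)
    (word_of X).
Proof.
have hy := word_of_in Y; move: (word_of Y) hy => y hy {Y}.
have sy : size y = n by case/andP: hy => /eqP.
have [n0|n_gt0] := posnP n.
  have y0 : y = [::] by apply: size0nil; rewrite sy.
  have sz X : word_of X = [::] by apply: size0nil; rewrite size_word.
  rewrite y0 !big1 ?mulr0 // => X _; rewrite sz /rate big_ord0 /= !add0r ?mulr0 //.
have nd := d_neq_e k_gt0.
pose y0 := nth ltr_e y 0; pose yl := nth ltr_e y n.-1.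
have ey : y = y0 :: behead y by rewrite /y0; case: (y) sy n_gt0 => // <-.
have eyl : y = rcons (take n.-1 y) yl.
  by rewrite -take_nth prednK // -?sy ?take_size // sy leqnn.
have ned : ~~ (0 < @ltr_e k < k)%N by [].
have ndd : ~~ (0 < @ltr_d k < k)%N by rewrite /= ltnn andbF.
rewrite /rate; under eq_bigr do rewrite !mulrDr.
rewrite !big_split /= sum_exchange // sum_exchange_out // mulrDr mulrDr.
have inL : \sum_(X : omega k n r) value (word_of X) *
    (if (word_of X == ltr_e :: behead (word_of X)) && (y == ltr_d :: behead
      (word_of X))
     then alpha else 0) = (y0 == ltr_d)%:R * (c * value (behead y)).
  have [yd|yd] := eqVneq y0 ltr_d; last first.
    rewrite mul0r big1 // => X _; case: ifP => [/andP[_ /eqP e]|]; rewrite ?mulr0 //.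
    by rewrite /y0 e eqxx in yd.
  have hye : in_omega n r (ltr_e :: behead y).
    by apply: (@in_omega_end _ _ _ y (behead y) ltr_d ltr_e) => //; rewrite {1}ey yd.
  transitivity (\sum_(X : omega k n r) (if word_of X == ltr_e :: behead y then
    value (word_of X) * alpha else 0)).
    apply: eq_bigr => X _; rewrite {1}ey yd eqseq_cons eqxx /=.
    have -> : (word_of X == ltr_e :: behead (word_of X)) && (behead y == behead
      (word_of X))
       = (word_of X == ltr_e :: behead y).
      by apply/andP/eqP => [[/eqP e /eqP e']|->]; [rewrite e' -e | rewrite /= !eqxx].
    by case: ifP; rewrite ?mulr0.
  by rewrite (sum_omega (fun w => value w * alpha)) // word_weight_e mul1r; ring.
have outL : \sum_(X : omega k n r)
    (if (y == ltr_e :: behead y) && (word_of X == ltr_d :: behead y)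
     then alpha else 0) = (y0 == ltr_e)%:R * alpha.
  have [ye|ye] := eqVneq y0 ltr_e; last first.
    rewrite mul0r big1 // => X _; case: ifP => // /andP[/eqP e].
    by rewrite /y0 e eqxx in ye.
  have hye : in_omega n r (ltr_d :: behead y).
    by apply: (@in_omega_end _ _ _ y (behead y) ltr_e ltr_d) => //; rewrite {1}ey ye.
  by rewrite -ye -ey eqxx (sum_omega (fun=> alpha)) // mul1r.
have inR : \sum_(X : omega k n r) value (word_of X) *
    (let u := take (size (word_of X)).-1 (word_of X) in
     if (word_of X == rcons u ltr_d) && (y == rcons u ltr_e)
     then beta else 0) = (yl == ltr_e)%:R * (c * value (take n.-1 y)).
  have [yd|yd] := eqVneq yl ltr_e; last first.
    rewrite mul0r big1 // => X _ /=; case: ifP => [/andP[_ /eqP e]|];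
      rewrite ?mulr0 //.
    by move: e; rewrite {1}eyl => /rcons_inj[_ e]; rewrite e eqxx in yd.
  have hye : in_omega n r (rcons (take n.-1 y) ltr_d).
    apply: (@in_omega_perm _ _ _ (ltr_d :: take n.-1 y));
      first by rewrite perm_sym perm_rcons.
    by apply: (@in_omega_end _ _ _ y (take n.-1 y) ltr_e ltr_d) => //;
      rewrite {1}eyl yd perm_rcons.
  transitivity (\sum_(X : omega k n r) (if word_of X == rcons (take n.-1 y) ltr_d
    then value (word_of X) * beta else 0)).
    apply: eq_bigr => X _ /=; rewrite {1}eyl yd eqseq_rcons eqxx andbT size_word.
    set x := word_of X; have sx : size x = n by apply: size_word.
    have -> : (x == rcons (take n.-1 x) ltr_d) && (take n.-1 y == take n.-1 x)
       = (x == rcons (take n.-1 y) ltr_d).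
      apply/andP/eqP => [[/eqP e /eqP e']|->]; first by rewrite e' -e.
      have st : size (take n.-1 y) = n.-1 by rewrite size_takel ?sy ?leq_pred.
      by rewrite -cats1 take_size_cat // cats1 !eqxx.
    by case: ifP; rewrite ?mulr0.
  by rewrite (sum_omega (fun w => value w * beta)) // word_weight_d // mul1r; ring.
have outR : \sum_(X : omega k n r)
    (let u := take (size y).-1 y in
     if (y == rcons u ltr_d) && (word_of X == rcons u ltr_e)
     then beta else 0) = (yl == ltr_d)%:R * beta.
  rewrite sy /=; have [yd|yd] := eqVneq yl ltr_d; last first.
    rewrite mul0r big1 // => X _; case: ifP => // /andP[/eqP e].
    by move: e; rewrite {1}eyl => /rcons_inj[e]; rewrite e eqxx in yd.
  have hye : in_omega n r (rcons (take n.-1 y) ltr_e).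
    apply: (@in_omega_perm _ _ _ (ltr_e :: take n.-1 y));
      first by rewrite perm_sym perm_rcons.
    by apply: (@in_omega_end _ _ _ y (take n.-1 y) ltr_d ltr_e) => //;
      rewrite {1}eyl yd perm_rcons.
  by rewrite -yd -eyl eqxx (sum_omega (fun=> beta)) // mul1r.
rewrite inL outL inR outR {inL outL inR outR}.
(* The sum of the bulk fluxes telescopes; val0 and vall cancel its two ends. *)
have flux : \sum_(0 <= i < n.-1)
       swap_rate q (nth ltr_e y i.+1) (nth ltr_e y i) * value (swap_at y i)
   - value y * \sum_(0 <= i < n.-1) swap_rate q (nth ltr_e y i) (nth ltr_e y i.+1)
   = hat y0 * value (behead y) - hat yl * value (take n.-1 y).
  rewrite big_distrr -sumrB /=.
  transitivity (\sum_(0 <= i < n.-1)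
     (- (hat (nth ltr_e y i.+1) * value (drop_at y i.+1))
      - - (hat (nth ltr_e y i) * value (drop_at y i)))).
    rewrite !big_nat; apply: eq_bigr => i hi; rewrite [value y * _]mulrC swap_flux.
      by rewrite opprK addrC.
    by lia.
  rewrite telescope_sumr // opprK addrC /drop_at take0 drop1 /=.
  by rewrite prednK // drop_oversize ?sy // cats0.
have val0 : (y0 == ltr_e)%:R * alpha * value y
  = (y0 == ltr_e)%:R * c * value (behead y).
  have [e|_] := eqVneq y0 ltr_e; last by rewrite !mul0r.
  by rewrite {1}ey e word_weight_e; ring.
have vall : (yl == ltr_d)%:R * beta * value y
  = (yl == ltr_d)%:R * c * value (take n.-1 y).
  have [e|_] := eqVneq yl ltr_d; last by rewrite !mul0r.
  by rewrite {1}eyl e word_weight_d //; ring.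
move: flux val0 vall; rewrite /hat.
set s1 := \sum_(0 <= i < _) _; set s2 := \sum_(0 <= i < _) _ => flux val0 vall.
have -> : s1 = value y * s2 + (hat y0 * value (behead y) - hat yl * value (take
  n.-1 y)).
  by rewrite -flux; ring.
rewrite /hat [value y * ((y0 == _)%:R * _)]mulrC val0 [value y * ((yl == _)%:R *
  _)]mulrC vall.
by ring.
Qed.

End Balance.

(** * Uniqueness of the stationary distribution *)

Section MarkovUniqueness.
Variables (R : realDomainType) (I : finType) (M : I -> I -> R).
Hypothesis M_ge0 : forall i j, 0 <= M i j.
Hypothesis M_row : forall i, \sum_j M i j = 1.
Variables (z : I) (m : I -> nat).
Hypothesis descend : forall i, i = z \/ exists j, (m j < m i)%N /\ 0 < M i j.

(** Mass moves down along positive transitions until it reaches z. *)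
Lemma invariant_pos (f : I -> R) : (forall i, 0 <= f i) ->
  (forall j, \sum_i f i * M i j = f j) -> forall i, 0 < f i -> 0 < f z.
Proof.
move=> f0 inv i; have [N] := ubnP (m i); elim: N i => // N IH i hN fi.
have [<- //|[j [lt Mij]]] := descend i.
apply: (IH j); first exact: leq_trans lt _.
rewrite -inv (bigD1 i) //= ltr_pwDl ?mulr_gt0 // sumr_ge0 // => l _.
by rewrite mulr_ge0.
Qed.

(** The positive part of an invariant vector is pointwise at most its image, and
    the two have the same total mass, so they are equal. *)
Lemma invariant_posPart (g : I -> R) : (forall j, \sum_i g i * M i j = g j) ->
  forall j, \sum_i Num.max (g i) 0 * M i j = Num.max (g j) 0.
Proof.
move=> inv; pose f i := Num.max (g i) 0.
have f0 i : 0 <= f i by rewrite /f le_max lexx orbT.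
have fg i : g i <= f i by rewrite /f le_max lexx.
have le j : 0 <= \sum_i f i * M i j - f j.
  rewrite subr_ge0 [f j]/f ge_max; apply/andP; split; last first.
    by apply: sumr_ge0 => i _; rewrite mulr_ge0.
  by rewrite -inv; apply: ler_sum => i _; rewrite ler_wpM2r.
have tot : \sum_j (\sum_i f i * M i j - f j) = 0.
  rewrite sumrB exchange_big /= -[X in _ - X](eq_bigr _ (fun i _ => mulr1 (f i))).
  apply/eqP; rewrite subr_eq0; apply/eqP; apply: eq_bigr => i _.
  by rewrite -big_distrr /= M_row.
move=> j; apply/eqP; rewrite -subr_eq0; apply/eqP.
exact: (psumr_eq0P (fun j _ => le j) tot).
Qed.

(** If g z <= 0, the positive part does not charge z, hence vanishes, and
    a nonpositive vector with sum 0 is 0. Otherwise the same applies to - g. *)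
Lemma invariant_sum0 (g : I -> R) : (forall j, \sum_i g i * M i j = g j) ->
  \sum_i g i = 0 -> forall i, g i = 0.
Proof.
wlog gz : g / g z <= 0 => [H|] inv sum0.
  have [/H|/ltW gz] := leP (g z) 0; first exact.
  move=> i; apply/eqP; rewrite -oppr_eq0; apply/eqP.
  apply: (H (fun i => - g i)) => [|j|].
  - by rewrite oppr_le0.
  - by rewrite -[in RHS]inv -sumrN; apply: eq_bigr => l _; rewrite mulNr.
  - by rewrite sumrN sum0 oppr0.
have gle0 i : g i <= 0.
  rewrite leNgt; apply/negP => gi.
  have pos l : 0 <= Num.max (g l) 0 by rewrite le_max lexx orbT.
  have := invariant_pos pos (invariant_posPart inv) (i := i).
  by rewrite !lt_max ltxx !orbF gi ltNge gz => /(_ isT).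
move=> i; apply/eqP; rewrite -oppr_eq0; apply/eqP.
apply: (psumr_eq0P (P := predT) (F := fun i => - g i)) => // [l _|].
  by rewrite oppr_ge0.
by rewrite sumrN sum0 oppr0.
Qed.

End MarkovUniqueness.

Section Uniqueness.
Variables (R : realType) (k n : nat) (r : nat -> nat) (alpha beta q : R).
Hypothesis k_gt0 : (0 < k)%N.
Hypotheses (q_ge0 : 0 <= q) (alpha_gt0 : 0 < alpha) (beta_gt0 : 0 < beta).
Implicit Types (w v : seq (letter k)) (X Y : omega k n r).

Lemma swap_rate_ge0 (a b : letter k) : 0 <= swap_rate q a b :> R.
Proof. by rewrite /swap_rate; case: ifP => // _; case: ifP. Qed.

Lemma rate_ge0 v w : 0 <= rate alpha beta q v w.
Proof.
rewrite /rate !addr_ge0 //=; last 2 first.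
- by case: ifP => // _; apply: ltW.
- by case: ifP => // _; apply: ltW.
by apply: sumr_ge0 => i _; apply: swap_rate_ge0.
Qed.

Lemma rate_corner_gt0 v i : is_corner v i -> 0 < rate alpha beta q v (swap_at v i).
Proof.
case/andP=> hi lt; rewrite /rate -addrA ltr_wpDr //.
  by rewrite addr_ge0 //=; case: ifP => // _; apply: ltW.
have hi' : (i < (size v).-1)%N by lia.
rewrite (bigD1 (Ordinal hi')) //= ltr_wpDr //; last by rewrite /swap_rate lt.
by apply: sumr_ge0 => j _; apply: swap_rate_ge0.
Qed.

Lemma rate_exit_gt0 (u : seq (letter k)) : 0 < rate alpha beta q (rcons u ltr_d)
  (rcons u ltr_e).
Proof.
rewrite /rate ltr_wpDl //=; last first.
  by rewrite size_rcons /= -cats1 take_size_cat // cats1 !eqxx.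
rewrite addr_ge0 //; last by case: ifP => // _; apply: ltW.
by apply: sumr_ge0 => j _; apply: swap_rate_ge0.
Qed.

(** The potential decreases at corner exchanges but not when the last letter d
    becomes e; the sum of the letters does the opposite. *)
Definition height w : nat := (potential w + \sum_(a <- w) a)%N.

Lemma height_swap w i : is_corner w i -> (height (swap_at w i) < height w)%N.
Proof.
move=> ci; have /andP[hi _] := ci.
by rewrite /height (perm_big _ (perm_swap_at hi)) ltn_add2r potential_swap_at.
Qed.

Lemma height_exit (u : seq (letter k)) :
  (height (rcons u ltr_e) < height (rcons u ltr_d))%N.
Proof.
have pot : potential (rcons u ltr_e) = potential (rcons u ltr_d).
  by elim: u => [|a u IH] /=; rewrite ?muln0 // IH !size_rcons.
by rewrite /height pot ltn_add2l -!cats1 !big_cat !big_seq1 ltn_add2l.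
Qed.

Lemma sorted_rcons_max u (a x : letter k) :
  sorted (fun a b : letter k => (a <= b)%N) (rcons u a) -> x \in rcons u a ->
  (x <= a)%N.
Proof.
have tr : transitive (fun a b : letter k => (a <= b)%N).
  by move=> b c d; exact: leq_trans.
rewrite sorted_pairwise // pairwise_rcons mem_rcons inE => /andP[/allP h _].
by case/predU1P => [->//|/h].
Qed.

Lemma count_sum w : (\sum_(a : letter k) count_mem a w)%N = size w.
Proof.
elim: w => [|x w IH] /=; first by rewrite big1.
rewrite big_split /= IH (bigD1 x) //= eqxx big1 // => a ax.
by rewrite eq_sym (negbTE ax).
Qed.

Lemma sorted_no_d_unique X Y :
  sorted (fun a b : letter k => (a <= b)%N) (word_of X) -> ltr_d \notin word_of X ->
  sorted (fun a b : letter k => (a <= b)%N) (word_of Y) -> ltr_d \notin word_of Y ->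
  X = Y.
Proof.
move=> sX dX sY dY; apply: word_of_inj.
apply: (@sorted_eq _ (fun a b : letter k => (a <= b)%N)) => //.
- by move=> b a c; exact: leq_trans.
- by move=> a b; rewrite -eqn_leq => /eqP /val_inj.
have cnt (a : letter k) : a != ltr_e -> count_mem a (word_of X)
  = count_mem a (word_of Y).
  move=> ae; have [->|ad] := eqVneq a ltr_d.
    by rewrite (count_memPn dX) (count_memPn dY).
  have ha : (0 < a < k)%N.
    have a0 : (0 < a)%N by rewrite lt0n.
    by rewrite a0 ltn_neqAle letter_leq andbT.
  have /andP[_ /forallP hX] := word_of_in X;
    have /andP[_ /forallP hY] := word_of_in Y.
  by rewrite (eqP (implyP (hX a) ha)) (eqP (implyP (hY a) ha)).
apply/allP => a _ /=; apply/eqP; have [->|] := eqVneq a ltr_e; last exact: cnt.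
have : (\sum_(b : letter k) count_mem b (word_of X)
        = \sum_(b : letter k) count_mem b (word_of Y))%N by rewrite !count_sum
          !size_word.
rewrite (bigD1 ltr_e) //= [in RHS](bigD1 ltr_e) //=.
by rewrite (eq_bigr _ (fun a ae => cnt a ae)) => /addIn.
Qed.

Lemma transition_row X : \sum_Y transition alpha beta q X Y = 1.
Proof.
rewrite (bigD1 X) //= {1}/transition eqxx /outgoing.
rewrite -[RHS](subrK (\sum_(Y | Y != X) rate alpha beta q (word_of X) (word_of Y) /
  n.+1%:R)).
by congr (_ + _); apply: eq_bigr => Y YX; rewrite /transition (negbTE YX).
Qed.

Lemma transition_ge0 X Y : outgoing alpha beta q X <= 1 ->
  0 <= transition alpha beta q X Y.
Proof.
move=> h; rewrite /transition; case: ifP => _; first by rewrite subr_ge0.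
by rewrite divr_ge0 // rate_ge0.
Qed.

(** A word without corners and with a d has that d at its right end. *)
Lemma descend_or_terminal X :
  (exists Y, (height (word_of Y) < height (word_of X))%N
             /\ 0 < transition alpha beta q X Y)
  \/ (sorted (fun a b : letter k =>
    (a <= b)%N) (word_of X) /\ ltr_d \notin word_of X).
Proof.
have go w : in_omega n r w -> (height w < height (word_of X))%N ->
    0 < rate alpha beta q (word_of X) w ->
    exists Y, (height (word_of Y) < height (word_of X))%N
             /\ 0 < transition alpha beta q X Y.
  case/in_omegaP => Y <- lt rt; exists Y; split=> //.
  rewrite /transition; case: eqP lt => [->|_ _]; first by rewrite ltnn.
  by rewrite divr_gt0.
have [/hasP[i _ ci]|/hasPn noc] := boolP (has (is_corner (word_of X)) (iota 0 (size
  (word_of X)))).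
  left; apply: (go _ _ (height_swap ci) (rate_corner_gt0 ci)).
  by apply: in_omega_swap (word_of_in X); case/andP: ci.
have srt : sorted (fun a b : letter k => (a <= b)%N) (word_of X).
  rewrite [word_of X]northwest_wordP; first exact: sorted_northwest_word.
  move=> i; apply/negP => ci; have /andP[/ltnW lt_i _] := ci.
  by move: (noc i); rewrite mem_iota ci lt_i => /(_ isT).
have [dX|] := boolP (ltr_d \in word_of X); last by right.
left; have [u [a eX]] : exists u a, word_of X = rcons u a.
  by case/lastP: (word_of X) dX => // u a _; exists u, a.
rewrite eX in srt dX.
have ad : a = ltr_d.
  apply/val_inj/eqP; rewrite eqn_leq letter_leq /=; exact: (sorted_rcons_max srt dX).
rewrite ad in eX; apply: (go (rcons u ltr_e)).
- apply: (@in_omega_perm _ _ _ (ltr_e :: u)); first by rewrite perm_sym perm_rcons.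
  apply: (@in_omega_end _ _ _ (word_of X) u ltr_d ltr_e) (word_of_in X) => //.
    by rewrite eX perm_rcons.
  by rewrite /= ltnn andbF.
- by rewrite eX height_exit.
- by rewrite eX rate_exit_gt0.
Qed.

Lemma stationary_unique (p p' : {ffun omega k n r -> R}) :
  (forall X, outgoing alpha beta q X <= 1) ->
  stationary alpha beta q p -> stationary alpha beta q p' -> p' = p.
Proof.
move=> out [_ s1 i1] [_ s2 i2].
have [W|none] := pickP (@predT (omega k n r)); last first.
  by apply/ffunP => X; have := none X.
move=> _; case: (@arg_minnP _ W predT (fun X => height (word_of X)) isT) => z _ zmin.
have zt : sorted (fun a b : letter k =>
  (a <= b)%N) (word_of z) /\ ltr_d \notin word_of z.
  case: (descend_or_terminal z) => // -[Y [lt _]].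
  by move: (zmin Y isT); rewrite leqNgt lt.
suff diff0 : forall X, p' X - p X = 0.
  by apply/ffunP => X; apply/eqP; rewrite -subr_eq0 diff0.
have M_ge0 X Y : 0 <= transition alpha beta q X Y by apply: transition_ge0.
have to_z X : X = z \/ exists Y, (height (word_of Y) < height (word_of X))%N
                              /\ 0 < transition alpha beta q X Y.
  case: (descend_or_terminal X) => [h|[h1 h2]]; [by right|left].
  by case: zt => h3 h4; apply: sorted_no_d_unique.
have inv Y : \sum_X (p' X - p X) * transition alpha beta q X Y = p' Y - p Y.
  by rewrite -i1 -i2 -sumrB; apply: eq_bigr => X _; exact: mulrBl.
apply: (invariant_sum0 M_ge0 transition_row to_z inv).
by rewrite sumrB s1 s2 subrr.
Qed.

Lemma balance_stationary (f : omega k n r -> R) :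
  (forall Y, \sum_X f X * rate alpha beta q (word_of X) (word_of Y)
             = f Y * \sum_(X : omega k n r) rate alpha beta q (word_of Y) (word_of
               X)) ->
  forall Y, \sum_X f X * transition alpha beta q X Y = f Y.
Proof.
move=> bal Y; have off : \sum_(X | X != Y) f X * rate alpha beta q (word_of X)
  (word_of Y)
    = f Y * \sum_(X | X != Y) rate alpha beta q (word_of Y) (word_of X).
  apply: (addrI (f Y * rate alpha beta q (word_of Y) (word_of Y))).
  have := bal Y; rewrite (bigD1 Y) // => ->.
  by rewrite (bigD1 Y) //= mulrDr.
rewrite (bigD1 Y) //= {1}/transition eqxx.
have -> : \sum_(X | X != Y) f X * transition alpha beta q X Y
  = f Y * outgoing alpha beta q Y.
  rewrite /outgoing -big_distrl /= mulrA -off big_distrl /=; apply: eq_bigr => X XY.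
  by rewrite /transition eq_sym (negbTE XY) mulrA.
by ring.
Qed.

End Uniqueness.

(** * Vertices of the boundary paths *)

Section EdgeVectors.
Variables (R : realType) (k : nat).
Hypothesis k_gt0 : (0 < k)%N.
Implicit Types a b : letter k.

(** The angle between the edge of the letter a and the west direction. *)
Definition turn (a : nat) : R := a%:R * (pi / (2 * k)%:R).

Let unit_turn : R := pi / (2 * k)%:R.

Let unit_turn_gt0 : 0 < unit_turn.
Proof. by rewrite divr_gt0 ?pi_gt0 // ltr0n muln_gt0. Qed.

Let unit_turn_k : unit_turn * k%:R = pi / 2.
Proof. by rewrite /unit_turn natrM; field; rewrite pnatr_eq0 -lt0n. Qed.

Lemma edgeE a : edge R a = (- cos (turn a), - sin (turn a)).
Proof.
have le2 : (a <= 2 * k)%N.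
  by rewrite (leq_trans (letter_leq a)) // mul2n -addnn leq_addr.
have nz : (2 * k)%:R != 0 :> R by rewrite pnatr_eq0 muln_eq0 /= -lt0n.
rewrite /edge natrB // /turn.
have -> : - (((2 * k)%:R - a%:R) * pi / (2 * k)%:R)
          = a%:R * (pi / (2 * k)%:R) - pi :> R.
  by move: (_%:R) nz => K nz; field.
by rewrite cosB sinB cospi sinpi; congr pair; ring.
Qed.

Lemma turn_bounds a : 0 <= turn a <= pi / 2.
Proof.
apply/andP; split; first by rewrite mulr_ge0 // ltW.
by rewrite /turn mulrC -unit_turn_k ler_pM2l // ler_nat letter_leq.
Qed.

(** All edges lie in an open half-plane. *)
Lemma edge_forward a : 0 < - (edge R a).1 - (edge R a).2.
Proof.
rewrite edgeE /= !opprK; have /andP[t0 t1] := turn_bounds a.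
have pi0 := pi_gt0 R.
have s0 : 0 <= sin (turn a) by apply: sin_ge0_pi; apply/andP; split; lra.
have c0 : 0 <= cos (turn a) by apply: cos_ge0_pihalf; apply/andP; split; lra.
by have := cos2Dsin2 (turn a); nra.
Qed.

Definition cross (v w : R * R) : R := v.1 * w.2 - v.2 * w.1.

Lemma cross_edge a b : cross (edge R a) (edge R b) = sin (turn b - turn a).
Proof. by rewrite /cross !edgeE sinB /=; ring. Qed.

Lemma turnB a b : (a <= b)%N -> turn b - turn a = (b - a)%:R * unit_turn.
Proof. by move=> le; rewrite /turn -mulrBl natrB. Qed.

Lemma cross_edge_ge0 a b : (a <= b)%N -> 0 <= cross (edge R a) (edge R b).
Proof.
move=> le; rewrite cross_edge; apply: sin_ge0_pi.
have /andP[a0 a1] := turn_bounds a; have /andP[b0 b1] := turn_bounds b.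
have := turnB le; have := pi_gt0 R => pi0.
have : 0 <= (b - a)%:R * unit_turn by rewrite mulr_ge0 // ltW.
by move=> h e; apply/andP; split; lra.
Qed.

(** Edges turn from west to south as the letters get heavier. *)
Lemma cross_edge_lt0 a b : (b < a)%N -> cross (edge R a) (edge R b) < 0.
Proof.
move=> lt; rewrite cross_edge -opprB sinN oppr_lt0; apply: sin_gt0_pi.
have /andP[a0 a1] := turn_bounds a; have /andP[b0 b1] := turn_bounds b.
have := turnB (ltnW lt); have := pi_gt0 R => pi0.
have : 0 < (a - b)%:R * unit_turn by rewrite mulr_gt0 // ltr0n subn_gt0.
by move=> h e; apply/andP; split; lra.
Qed.

End EdgeVectors.

Section Prefixes.
Variables (R : realType) (k : nat).
Hypothesis k_gt0 : (0 < k)%N.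
Local Notation label := (letter k * nat)%type.
Implicit Types (X Y : seq label) (x y l : label).

Definition vsum X : R * R := \sum_(x <- X) edge R x.1.

Lemma linear_vsum (p r : R) X :
  p * (vsum X).1 + r * (vsum X).2
  = \sum_(x <- X) (p * (edge R x.1).1 + r * (edge R x.1).2).
Proof.
rewrite /vsum; elim: X => [|x X IH]; first by rewrite !big_nil /=; ring.
by rewrite !big_cons -IH /=; ring.
Qed.

Lemma vsum_perm X Y : perm_eq X Y -> vsum X = vsum Y.
Proof. exact: perm_big. Qed.

Lemma vsum_eq0 X : vsum X = 0 -> X = [::].
Proof.
move=> h; have := linear_vsum (-1) (-1) X; rewrite h /= !mulr0 addr0.
have pos (y : label) : 0 < -1 * (edge R y.1).1 + -1 * (edge R y.1).2.
  by have := edge_forward R k_gt0 y.1; lra.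
case: X {h} => // x X; rewrite big_cons => /esym /eqP.
have rest_ge0 : 0 <= \sum_(y <- X) (-1 * (edge R y.1).1 + -1 * (edge R y.1).2).
  by apply: sumr_ge0 => y _; apply: ltW.
by rewrite paddr_eq0 ?(ltW (pos x)) // (gt_eqF (pos x)).
Qed.

Lemma min_letter X : X != [::] ->
  exists2 x, x \in X & forall y, y \in X -> (x.1 <= y.1)%N.
Proof.
elim: X => // x X IH _; have [->|/IH[m mX mmin]] := eqVneq X [::].
  by exists x => [|y]; rewrite !inE // => /eqP ->.
have [le|lt] := leqP x.1 m.1.
  exists x; first exact: mem_head.
  by move=> y; rewrite inE => /predU1P[->//|/mmin]; apply: leq_trans.
exists m; first by rewrite inE mX orbT.
by move=> y; rewrite inE => /predU1P[->|/mmin//]; apply: ltnW.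
Qed.

(** The lightest letter m of X separates the cones: the cross product with its
    edge is nonnegative on the edges of X and negative on those of Y. *)
Lemma vsum_cone X Y :
  (forall x y, x \in X -> y \in Y -> (y.1 < x.1)%N) -> vsum X = vsum Y ->
  X = [::] /\ Y = [::].
Proof.
move=> sep eqv; have [X0|/min_letter[m mX mmin]] := eqVneq X [::].
  by split=> //; apply: vsum_eq0; rewrite -eqv X0 /vsum big_nil.
suff Y0 : Y = [::].
  by split=> //; apply: vsum_eq0; rewrite eqv Y0 /vsum big_nil.
pose crossm v := cross (edge R m.1) v.
have crossE Z : crossm (vsum Z) = \sum_(z <- Z) crossm (edge R z.1).
  have h v : crossm v = - (edge R m.1).2 * v.1 + (edge R m.1).1 * v.2.
    by rewrite /crossm /cross; ring.
  by rewrite h linear_vsum; apply: eq_bigr => z _; rewrite h.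
have : 0 <= crossm (vsum X).
  rewrite crossE big_seq sumr_ge0 // => x /mmin le.
  exact: cross_edge_ge0.
rewrite eqv crossE; case: Y {eqv crossE} sep => // y Y sep; rewrite big_cons leNgt.
case/negP; rewrite -[X in _ < X]addr0 ltr_leD //.
  by apply: cross_edge_lt0 => //; apply: sep; rewrite ?mem_head.
rewrite big_seq sumr_le0 // => z zY; apply/ltW/cross_edge_lt0 => //.
by apply: sep => //; rewrite inE zY orbT.
Qed.

(** Common letters cancel, which leaves the letters of X only and those of Y
    only, to which [vsum_cone] applies. *)
Lemma vsum_inj X Y : uniq X -> uniq Y ->
  (forall x y, x \in X -> x \notin Y -> y \in Y -> y \notin X -> (y.1 < x.1)%N) ->
  vsum X = vsum Y -> X =i Y.
Proof.
move=> uX uY sep eqv.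
have splt (A B : seq label) :
    vsum A = vsum [seq x <- A | x \in B] + vsum [seq x <- A | x \notin B].
  rewrite /vsum -big_cat /=; apply: perm_big.
  by rewrite perm_sym; apply/permPl/perm_filterC.
have com : vsum [seq x <- X | x \in Y] = vsum [seq x <- Y | x \in X].
  apply/vsum_perm/uniq_perm; rewrite ?filter_uniq // => x.
  by rewrite !mem_filter andbC.
move: eqv; rewrite (splt X Y) (splt Y X) com => /addrI /vsum_cone[].
  by move=> x y; rewrite !mem_filter => /andP[? ?] /andP[? ?]; apply: sep.
move=> XY YX z; apply/idP/idP => hz; apply/negPn/negP => nz.
  by have : z \in [::] by rewrite -XY mem_filter nz.
by have : z \in [::] by rewrite -YX mem_filter nz.
Qed.

End Prefixes.

(** * Strips of a tiling *)

(** If nx links each element to the next one with the same strip label, then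
    being strictly reachable means having the same label and coming later. *)
Lemma strict_connectE (I : finType) (L : eqType) (idx : I -> nat)
    (lab : I -> option L) (nx : rel I) :
  injective idx ->
  (forall s t, nx s t -> [/\ lab s : bool, lab s = lab t & (idx s < idx t)%N]) ->
  (forall s t, lab s -> lab s = lab t -> (idx s < idx t)%N ->
     (forall u, (idx s < idx u < idx t)%N -> lab u <> lab s) -> nx s t) ->
  forall s t, [exists u, nx s u && connect nx u t]
              = [&& lab s : bool, lab s == lab t & (idx s < idx t)%N].
Proof.
move=> idx_inj nxP nextI s t; apply/existsP/and3P => [[u /andP[su ut]]|].
  have [ls lsu lt_su] := nxP _ _ su.
  suff [lut le_ut] : lab u = lab t /\ (idx u <= idx t)%N.
    by split=> //; [rewrite lsu lut | apply: leq_trans le_ut].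
  case/connectP: ut => p pth ->{t}; elim: p u pth {su lsu lt_su} => //= v p IH u.
  case/andP=> /nxP[_ -> /ltnW le_uv] /IH[-> le]; split=> //.
  exact: leq_trans le.
have [m] := ubnP (idx t - idx s)%N; elim: m s => // m IH s hm [ls /eqP lst lt_st].
(* u is the next element with the label of s. *)
case: (@arg_minnP _ t (fun u => (lab u == lab s) && (idx s < idx u)%N) idx).
  by rewrite lst eqxx.
move=> u /andP[/eqP lus lt_su] umin; exists u; apply/andP; split.
  apply: nextI => // v /andP[lt_sv lt_vu] lvs.
  by move: (umin v); rewrite lvs eqxx lt_sv leqNgt lt_vu => /(_ isT).
have : (idx u <= idx t)%N by apply: umin; rewrite lst eqxx.
rewrite leq_eqVlt => /predU1P[/idx_inj -> //|lt_ut].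
have [] := IH u; last 1 first.
- by move=> v /andP[uv vt]; apply: connect_trans vt; apply: connect1.
- by apply: leq_trans (_ : idx t - idx s <= m)%N => //; lia.
- by rewrite lus -lst eqxx; split.
Qed.

Section Runs.
Variables (R : realType) (k : nat).
Hypothesis k_gt0 : (0 < k)%N.
Local Notation label := (letter k * nat)%type.
Implicit Types (X Y Z : seq label) (x y l : label) (a b c : nat).

(** One execution of the tiling procedure. The letters carry distinct tags, so
    that each of them can be followed through the exchanges; [boundary a] is the
    southeast boundary after a steps, and step a places a tile on the corner
    formed by [heavy a] and [light a]. Values beyond the length are arbitrary. *)
Record run := Run {
  run_length : nat;
  boundary : nat -> seq label;
  pre_corner : nat -> seq label;
  heavy : nat -> label;
  light : nat -> label;
  post_corner : nat -> seq label;
  boundary0_uniq : uniq (boundary 0);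
  run_step : forall a, (a < run_length)%N ->
    [/\ boundary a = pre_corner a ++ [:: heavy a, light a & post_corner a],
        boundary a.+1 = pre_corner a ++ [:: light a, heavy a & post_corner a]
      & ((light a).1 < (heavy a).1)%N] }.

Definition run_tile (u : run) a : tile R k :=
  (vsum R (pre_corner u a), ((heavy u a).1, (light u a).1)).

Definition run_tiles u : seq (tile R k) := mkseq (run_tile u) (run_length u).

Variable u : run.

Lemma boundary_uniq a : (a <= run_length u)%N -> uniq (boundary u a).
Proof.
elim: a => [|a IH] ha; first exact: boundary0_uniq.
have [e1 e2 _] := run_step ha; move: (IH (ltnW ha)).
rewrite e1 e2; congr is_true; apply: perm_uniq; rewrite perm_cat2l.
by apply/permP => p /=; rewrite addnCA.
Qed.

(** Letters are exchanged only from heavy-light to light-heavy. So if y precedes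
    a cut of an earlier boundary that x follows, and the reverse holds at a cut
    of a later one, then y has passed x. Only a cut in the middle of the corner
    is affected by a step; it is compared with the cut on one of its sides. *)
Lemma swapped_take d a i j x y : (a + d <= run_length u)%N ->
  y \in take i (boundary u a) -> y \notin take j (boundary u (a + d)) ->
  x \notin take i (boundary u a) -> x \in take j (boundary u (a + d)) ->
  (x.1 < y.1)%N.
Proof.
elim: d a i => [|d IH] a i had yi yj xi xj.
  rewrite addn0 in yj xj; have [le|/ltnW le] := leqP i j.
    by case/negP: yj; move: yi; rewrite -(take_takel _ le); apply: mem_take.
  by case/negP: xi; move: xj; rewrite -(take_takel _ le); apply: mem_take.
rewrite -addSnnS in had yj xj.
have [e1 e2 lt] := run_step (leq_trans (leq_addr d a.+1) had).
set P := pre_corner u a in e1 e2; have [le|gt] := leqP i (size P).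
  have eqt : take i (boundary u a.+1)
    = take i (boundary u a) by rewrite e1 e2 !takel_cat.
  by apply: (IH a.+1 i); rewrite ?eqt.
have takeS Q Z : take i (P ++ Q ++ Z) = P ++ take (i - size P) (Q ++ Z).
  by rewrite take_cat ltnNge (ltnW gt).
have [i1|i1] := eqVneq i (size P).+1.
  have tk : take i (boundary u a) = rcons P (heavy u a).
    by rewrite e1 (takeS [::]) i1 subSnn /= ?take0 cats1.
  rewrite tk !mem_rcons !inE negb_or in yi xi; case/andP: xi => xB xP.
  have [yB|yB] := eqVneq y (heavy u a); last first.
    have tP : take (size P) (boundary u a.+1) = P by rewrite e2 take_size_cat.
    apply: (IH a.+1 (size P)) => //; rewrite tP //.
    by rewrite (negbTE yB) in yi.
  have [->|xC] := eqVneq x (light u a); first by rewrite yB.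
  have tP : take (size P).+2 (boundary u a.+1) = P ++ [:: light u a; heavy u a].
    by rewrite e2 take_cat ltnNge -addn2 leq_addr /= addKn /= ?take0.
  apply: (IH a.+1 (size P).+2) => //; rewrite tP mem_cat !inE.
    by rewrite yB eqxx !orbT.
  by rewrite !negb_or xP xC xB.
have [m em] : exists m, (i - size P = m.+2)%N by exists (i - size P).-2; lia.
have mt z : (z \in take i (boundary u a.+1)) = (z \in take i (boundary u a)).
  rewrite e1 e2 !(takeS [::]) em /= !mem_cat !inE; congr (_ || _).
  by rewrite orbCA.
by apply: (IH a.+1 i); rewrite ?mt.
Qed.

Lemma swapped a b X X' Y Y' x y : (a <= b <= run_length u)%N ->
  boundary u a = X ++ X' -> boundary u b = Y ++ Y' ->
  y \in X -> y \notin Y -> x \notin X -> x \in Y -> (x.1 < y.1)%N.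
Proof.
case/andP=> /subnKC <- hb ea eb yX yY xX xY.
apply: (@swapped_take (b - a) a (size X) (size Y)) => //;
  by rewrite ?ea ?eb take_size_cat.
Qed.

Lemma notin_prefix a X l Y : (a <= run_length u)%N -> boundary u a
  = X ++ l :: Y -> l \notin X.
Proof.
move=> /boundary_uniq + e; rewrite e cat_uniq => /and3P[_ /hasPn h _].
by apply: h; rewrite mem_head.
Qed.

(** A point of the plane determines the letters read before it, at any time. *)
Lemma same_vertex a b X X' Y Y' : (a <= b <= run_length u)%N ->
  boundary u a = X ++ X' -> boundary u b = Y ++ Y' ->
  vsum R X = vsum R Y -> X =i Y.
Proof.
move=> hab ea eb; have /andP[le_ab le_b] := hab.
have := boundary_uniq le_b; have := boundary_uniq (leq_trans le_ab le_b).
rewrite ea eb !cat_uniq => /and3P[uX _ _] /and3P[uY _ _].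
apply: vsum_inj => // y x yX yY xY xX; exact: (swapped hab ea eb).
Qed.

(** Equal letters are never exchanged. *)
Lemma same_next a b X X' Y Y' l l' : (a <= b <= run_length u)%N ->
  boundary u a = X ++ l :: X' -> boundary u b = Y ++ l' :: Y' ->
  X =i Y -> l.1 = l'.1 -> l = l'.
Proof.
move=> hab ea eb eXY ll; apply/eqP/negPn/negP => nll.
have /andP[le_ab le_b] := hab.
have lX := notin_prefix (leq_trans le_ab le_b) ea.
have lY := notin_prefix le_b eb.
rewrite -cat_rcons in ea; rewrite -cat_rcons in eb.
suff : (l'.1 < l.1)%N by rewrite ll ltnn.
apply: (swapped hab ea eb); rewrite ?mem_rcons ?inE ?eqxx // negb_or.
  by rewrite nll -eXY lX.
by rewrite eq_sym nll eXY lY.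
Qed.

Lemma step_neq a : (a < run_length u)%N -> light u a != heavy u a.
Proof. by case/run_step => _ _; apply: contraTneq => ->; rewrite ltnn. Qed.

(** Positions alone do not say which tile was placed first. If b were not later
    than a, the light letter of b would have moved back behind the heavy one. *)
Lemma next_above_lt a b : (a < run_length u)%N -> (b < run_length u)%N ->
  (light u a).1 = (light u b).1 ->
  vsum R (pre_corner u a) = vsum R (rcons (pre_corner u b) (heavy u b)) ->
  light u a = light u b /\ (a < b)%N.
Proof.
move=> ha hb ll eqv; have [a1 a2 a3] := run_step ha; have [b1 b2 b3] := run_step hb.
rewrite -cat_rcons in b1; have [lt|le] := ltnP a b.
  have h : (a < b <= run_length u)%N by rewrite lt ltnW.
  by split=> //; apply: (same_next h a2 b1 _ ll); apply: (same_vertex h a2 b1).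
(* Now b comes first, and from then on light b precedes heavy b; but at the
   common vertex of boundary a.+1, heavy b has been read and light b has not. *)
have h : (b <= a.+1 <= run_length u)%N by rewrite leqW.
have eX := same_vertex h b1 a2 (esym eqv).
have eC := same_next h b1 a2 eX (esym ll).
have Ca := notin_prefix ha a2.
have Bb : heavy u b \notin rcons (pre_corner u b) (light u b).
  by apply: (@notin_prefix b.+1 _ _ (post_corner u b)) => //; rewrite cat_rcons.
rewrite -cat_rcons in b2.
suff : ((heavy u b).1 < (light u b).1)%N by rewrite ltnNge (ltnW b3).
have h' : (b.+1 <= a.+1 <= run_length u)%N by rewrite ltnS le.
apply: (swapped h' b2 a2 _ _ Bb).
- by rewrite mem_rcons mem_head.
- by rewrite eC.
- by rewrite -eX mem_rcons mem_head.
Qed.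

(** The mirror image of [next_above_lt]. *)
Lemma next_left_lt a b : (a < run_length u)%N -> (b < run_length u)%N ->
  (heavy u a).1 = (heavy u b).1 ->
  vsum R (rcons (pre_corner u a) (light u a)) = vsum R (pre_corner u b) ->
  heavy u a = heavy u b /\ (a < b)%N.
Proof.
move=> ha hb ll eqv; have [a1 a2 a3] := run_step ha; have [b1 b2 b3] := run_step hb.
rewrite -cat_rcons in a2; have [lt|le] := ltnP a b.
  have h : (a < b <= run_length u)%N by rewrite lt ltnW.
  by split=> //; apply: (same_next h a2 b1 _ ll); apply: (same_vertex h a2 b1).
have h : (b <= a.+1 <= run_length u)%N by rewrite leqW.
have eX := same_vertex h b1 a2 (esym eqv).
have eB := same_next h b1 a2 eX (esym ll).
have Cb := notin_prefix (ltnW (hb : b < run_length u)%N : b <= run_length u)%N b1.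
have Bb : heavy u b \notin rcons (pre_corner u b) (light u b).
  by apply: (@notin_prefix b.+1 _ _ (post_corner u b)) => //; rewrite cat_rcons.
have Cb' := notin_prefix hb b2.
rewrite -cat_rcons in b2; rewrite -cat_rcons in a2.
suff : ((heavy u b).1 < (light u b).1)%N by rewrite ltnNge (ltnW b3).
have h' : (b.+1 <= a.+1 <= run_length u)%N by rewrite ltnS le.
apply: (swapped h' b2 a2 _ _ Bb).
- by rewrite mem_rcons mem_head.
- by rewrite mem_rcons inE negb_or -eX Cb' -eB step_neq.
- by rewrite eB mem_rcons mem_head.
Qed.

Lemma run_tile_inj a b : (a < b < run_length u)%N -> run_tile u a <> run_tile u b.
Proof.
case/andP=> lt hb [eqv eB eC]; have ha := ltn_trans lt hb.
have [a1 a2 a3] := run_step ha; have [b1 b2 b3] := run_step hb.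
have h : (a <= b <= run_length u)%N by rewrite (ltnW lt) ltnW.
have eX := same_vertex h a1 b1 eqv.
have eqB := same_next h a1 b1 eX eB.
have Ba : heavy u a \notin rcons (pre_corner u a) (light u a).
  by apply: (@notin_prefix a.+1 _ _ (post_corner u a)) => //; rewrite cat_rcons.
have Ca := notin_prefix ha a2.
rewrite -cat_rcons in a2; rewrite -cat_rcons in b1.
(* Step a has put light a in front of heavy a for good, but the two are again
   in the opposite order at step b. *)
suff : ((heavy u a).1 < (light u a).1)%N by rewrite ltnNge (ltnW a3).
apply: (@swapped a.+1 b _ _ _ _ (heavy u a) (light u a) _ a2 b1).
- by rewrite lt ltnW.
- by rewrite mem_rcons mem_head.
- by rewrite mem_rcons inE negb_or -eX Ca -eqB step_neq.
- exact: Ba.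
- by rewrite eqB mem_rcons mem_head.
Qed.

Lemma run_tiles_uniq : uniq (run_tiles u).
Proof.
apply/(uniqP (run_tile u 0)) => a b; rewrite !inE size_mkseq => ha hb.
rewrite !nth_mkseq // => e; case: (ltngtP a b) => // lt; exfalso.
  by apply: (@run_tile_inj a b); rewrite ?lt.
by apply: (@run_tile_inj b a); rewrite ?lt.
Qed.

Fixpoint labels_before l X : seq label :=
  if X is x :: X' then if x == l then [::] else x :: labels_before l X' else [::].

Lemma labels_before_cat l X Y : l \notin X -> labels_before l (X ++ l :: Y) = X.
Proof.
elim: X => [|x X IH] /=; first by rewrite eqxx.
by rewrite inE negb_or eq_sym => /andP[/negbTE -> /IH ->].
Qed.

Lemma labels_before_swap l x y X Y : l != x -> l != y ->
  perm_eq (labels_before l (X ++ [:: x, y & Y])) (labels_before l (X ++ [:: y,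
    x & Y])).
Proof.
move=> nx ny; elim: X => [|z X IH] /=; last by case: eqP; rewrite ?perm_cons.
rewrite ![_ == l]eq_sym (negbTE nx) (negbTE ny).
by apply/permP => p /=; rewrite addnCA.
Qed.

(** The edge of the letter l stays in place as long as l is not part of a
    corner that is exchanged. *)
Lemma labels_before_const l a b : (a <= b <= run_length u)%N ->
  (forall c, (a <= c < b)%N -> l != heavy u c /\ l != light u c) ->
  vsum R (labels_before l (boundary u a)) = vsum R (labels_before l (boundary u b)).
Proof.
case/andP=> le hb; elim: b le hb => [|b IH].
  by rewrite leqn0 => /eqP ->.
rewrite leq_eqVlt => /predU1P[-> //|le] hb hc.
rewrite IH ?(ltnW hb) //; last by move=> c /andP[h1 h2]; apply: hc; rewrite h1 ltnW.
have [b1 b2 _] := run_step hb; rewrite b1 b2; apply: vsum_perm.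
have [|h1 h2] := hc b; first by rewrite -ltnS le ltnSn.
exact: labels_before_swap.
Qed.

(** The e-edge on top of the tile of step a waits there until its letter is
    exchanged again, by the next tile of the strip. *)
Lemma next_above_vertex a b : (a < b < run_length u)%N -> light u a = light u b ->
  (forall c, (a < c < b)%N -> light u a != heavy u c /\ light u a != light u c) ->
  vsum R (pre_corner u a) = vsum R (rcons (pre_corner u b) (heavy u b)).
Proof.
case/andP=> lt hb eC hc; have ha := ltn_trans lt hb.
have [_ a2 _] := run_step ha; have [b1 _ _] := run_step hb.
have le : (a < b <= run_length u)%N by rewrite lt ltnW.
rewrite -cat_rcons in b1; have := labels_before_const le hc.
by rewrite a2 b1 labels_before_cat ?(notin_prefix ha a2) // eC
           labels_before_cat // (notin_prefix (ltnW hb) b1).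
Qed.

Lemma next_left_vertex a b : (a < b < run_length u)%N -> heavy u a = heavy u b ->
  (forall c, (a < c < b)%N -> heavy u a != heavy u c /\ heavy u a != light u c) ->
  vsum R (rcons (pre_corner u a) (light u a)) = vsum R (pre_corner u b).
Proof.
case/andP=> lt hb eC hc; have ha := ltn_trans lt hb.
have [_ a2 _] := run_step ha; have [b1 _ _] := run_step hb.
have le : (a < b <= run_length u)%N by rewrite lt ltnW.
rewrite -cat_rcons in a2; have := labels_before_const le hc.
by rewrite a2 b1 labels_before_cat ?(notin_prefix ha a2) // eC
           labels_before_cat // (notin_prefix (ltnW hb) b1).
Qed.

Implicit Types s t : seq_sub (run_tiles u).

Definition tile_step s : nat := index (val s) (run_tiles u).

Lemma tile_step_lt s : (tile_step s < run_length u)%N.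
Proof. by have := valP s; rewrite -index_mem size_mkseq. Qed.

Lemma run_tile_step s : run_tile u (tile_step s) = val s.
Proof.
by rewrite -[RHS](nth_index (run_tile u 0) (valP s)) nth_mkseq // tile_step_lt.
Qed.

Lemma tile_step_inj : injective tile_step.
Proof. by move=> s t e; apply: val_inj; rewrite /= -!run_tile_step e. Qed.

(** An e-strip is named by the labelled letter e that its tiles share; in a corner
    of the boundary e can only be the lighter letter, and d the heavier one. *)
Definition e_strip a : option label :=
  if (light u a).1 == ltr_e then Some (light u a) else None.
Definition d_strip a : option label :=
  if (heavy u a).1 == ltr_d then Some (heavy u a) else None.

Lemma heavy_neq_e a : (a < run_length u)%N -> (heavy u a).1 != ltr_e.
Proof. by case/run_step => _ _; apply: contraTneq => ->. Qed.

Lemma light_neq_d a : (a < run_length u)%N -> (light u a).1 != ltr_d.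
Proof.
case/run_step => _ _; apply: contraTneq => ->.
by rewrite -leqNgt letter_leq.
Qed.

Lemma vsum_rcons X x : vsum R (rcons X x) = vsum R X + edge R x.1.
Proof. by rewrite /vsum big_rcons /= addrC. Qed.

Lemma next_above_run a b : (a < run_length u)%N -> (b < run_length u)%N ->
  next_above (run_tile u a) (run_tile u b) ->
  [/\ e_strip a : bool, e_strip a = e_strip b & (a < b)%N].
Proof.
move=> ha hb; rewrite /next_above /= => /and3P[ea eb /eqP].
rewrite -vsum_rcons => /(next_above_lt ha hb)[]; first by rewrite (eqP ea) (eqP eb).
by move=> el lt; rewrite /e_strip ea eb el.
Qed.

Lemma run_next_above a b : (b < run_length u)%N ->
  e_strip a -> e_strip a = e_strip b -> (a < b)%N ->
  (forall c, (a < c < b)%N -> e_strip c <> e_strip a) ->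
  next_above (run_tile u a) (run_tile u b).
Proof.
move=> hb; rewrite /e_strip /next_above /=.
have [ea _|//] := eqVneq (light u a).1 ltr_e.
have [eb [el] lt none|//] := eqVneq (light u b).1 ltr_e.
rewrite -vsum_rcons; apply/eqP/next_above_vertex; rewrite ?lt //.
move=> c hc; have hcl : (c < run_length u)%N by case/andP: hc => _ h;
  apply: ltn_trans h hb.
split; first by apply: contraNneq (heavy_neq_e hcl) => <-; rewrite ea.
by apply/eqP => h; apply: (none c hc); rewrite -h ea eqxx.
Qed.

Lemma next_left_run a b : (a < run_length u)%N -> (b < run_length u)%N ->
  next_left (run_tile u a) (run_tile u b) ->
  [/\ d_strip a : bool, d_strip a = d_strip b & (a < b)%N].
Proof.
move=> ha hb; rewrite /next_left /= => /and3P[ea eb /eqP].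
rewrite -vsum_rcons => /(next_left_lt ha hb)[]; first by rewrite (eqP ea) (eqP eb).
by move=> el lt; rewrite /d_strip ea eb el.
Qed.

Lemma run_next_left a b : (b < run_length u)%N ->
  d_strip a -> d_strip a = d_strip b -> (a < b)%N ->
  (forall c, (a < c < b)%N -> d_strip c <> d_strip a) ->
  next_left (run_tile u a) (run_tile u b).
Proof.
move=> hb; rewrite /d_strip /next_left /=.
have [ea _|//] := eqVneq (heavy u a).1 ltr_d.
have [eb [el] lt none|//] := eqVneq (heavy u b).1 ltr_d.
rewrite -vsum_rcons; apply/eqP/next_left_vertex; rewrite ?lt //.
move=> c hc; have hcl : (c < run_length u)%N by case/andP: hc => _ h;
  apply: ltn_trans h hb.
split; last by apply: contraNneq (light_neq_d hcl) => <-; rewrite ea.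
by apply/eqP => h; apply: (none c hc); rewrite -h ea eqxx.
Qed.

Lemma tile_step_surj a : (a < run_length u)%N -> exists s, tile_step s = a.
Proof.
move=> ha; have hT : run_tile u a \in run_tiles u.
  by apply/mapP; exists a; rewrite ?mem_iota.
exists (SeqSub hT); rewrite /tile_step /= -(nth_mkseq (run_tile u 0) (run_tile u) ha).
by rewrite index_uniq ?run_tiles_uniq ?size_mkseq.
Qed.

(** Geometric strips are trajectories of letters. *)
Lemma aboveE s t :
  above s t = [&& e_strip (tile_step s) : bool,
    e_strip (tile_step s) == e_strip (tile_step t)
                & (tile_step s < tile_step t)%N].
Proof.
apply: (@strict_connectE _ _ tile_step (fun s => e_strip (tile_step s))
          (fun s t => next_above (val s) (val t)) tile_step_inj) => {}s {}t.
  rewrite -!run_tile_step; move: (tile_step s) (tile_step t) (tile_step_lt s)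
    (tile_step_lt t) => a b.
  exact: next_above_run.
move=> h1 h2 h3 h4; rewrite -!run_tile_step; apply: run_next_above h1 h2 h3 _.
  exact: tile_step_lt.
move=> c hc; have [] := @tile_step_surj c.
  by case/andP: hc => _ h; apply: ltn_trans h (tile_step_lt t).
by move=> v vc; move: (h4 v); rewrite vc; apply.
Qed.

Lemma left_ofE s t :
  left_of s t = [&& d_strip (tile_step s) : bool,
    d_strip (tile_step s) == d_strip (tile_step t)
                  & (tile_step s < tile_step t)%N].
Proof.
apply: (@strict_connectE _ _ tile_step (fun s => d_strip (tile_step s))
          (fun s t => next_left (val s) (val t)) tile_step_inj) => {}s {}t.
  rewrite -!run_tile_step; move: (tile_step s) (tile_step t) (tile_step_lt s)
    (tile_step_lt t) => a b.
  exact: next_left_run.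
move=> h1 h2 h3 h4; rewrite -!run_tile_step; apply: run_next_left h1 h2 h3 _.
  exact: tile_step_lt.
move=> c hc; have [] := @tile_step_surj c.
  by case/andP: hc => _ h; apply: ltn_trans h (tile_step_lt t).
by move=> v vc; move: (h4 v); rewrite vc; apply.
Qed.

End Runs.

(** Tag each letter of w with its position and follow the procedure. *)
Lemma maximal_tiling_run (R : realType) (k : nat) (w : seq (letter k))
    (T : seq (tile R k)) : maximal_tiling w T ->
  exists u : run k, [/\ unzip1 (boundary u 0) = w,
    sorted (fun a b : letter k => (a <= b)%N) (unzip1 (boundary u (run_length u)))
    & T = run_tiles R u].
Proof.
suff gen : maximal_tiling w T -> forall X : seq (letter k * nat),
    uniq X -> unzip1 X = w -> exists2 u : run k, boundary u 0 = X &
    sorted (fun a b : letter k => (a <= b)%N) (unzip1 (boundary u (run_length u)))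
    /\ T = run_tiles R u.
  move=> /gen /(_ (zip w (iota 0 (size w)))) [].
  - apply: (@map_uniq _ _ snd); rewrite -/(unzip2 _) unzip2_zip ?size_iota //.
    exact: iota_uniq.
  - by rewrite unzip1_zip // size_iota.
  by move=> u e [h1 h2]; exists u; rewrite e unzip1_zip ?size_iota.
elim => {w T} [w hw|w i T hw [ci _] _ IH] X uX eX.
  exists (@Run k 0 (fun=> X) (fun=> [::]) (fun=> (ltr_e, 0%N)) (fun=> (ltr_e, 0%N))
     (fun=> [::]) uX (fun a (h : (a < 0)%N) => False_ind _ (notF h))) => //=.
  by rewrite eX hw; split=> //; apply: sorted_northwest_word.
have /andP[hi lt] := ci; have szX : size X = size w by rewrite -eX size_map.
pose x0 : letter k * nat := (ltr_e, 0%N).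
have eX2 : X = take i X ++ [:: nth x0 X i, nth x0 X i.+1 & drop i.+2 X].
  rewrite -{1}(cat_take_drop i X) (drop_nth x0) ?(drop_nth x0 (n := i.+1)) ?szX //.
  exact: ltnW.
pose X' := take i X ++ [:: nth x0 X i.+1, nth x0 X i & drop i.+2 X].
have uX' : uniq X'.
  move: uX; rewrite {1}eX2; congr is_true; apply: perm_uniq; rewrite perm_cat2l.
  by apply/permP => p /=; rewrite addnCA.
have nX j : (j < size w)%N -> (nth x0 X j).1 = nth ltr_e w j.
  by move=> h; rewrite -eX (nth_map x0) ?szX.
have eX' : unzip1 X' = swap_at w i.
  by rewrite /unzip1 /X' /swap_at map_cat /= map_take map_drop -/(unzip1 X) eX !nX
    // ltnW.
have [u0 e0 [srt eT]] := IH X' uX' eX'.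
have step : forall a, (a < (run_length u0).+1)%N ->
   [/\ (fun n => if n is m.+1 then boundary u0 m else X) a =
       (fun n => if n is m.+1 then pre_corner u0 m else take i X) a ++
       [:: (fun n => if n is m.+1 then heavy u0 m else nth x0 X i) a,
           (fun n => if n is m.+1 then light u0 m else nth x0 X i.+1) a
         & (fun n => if n is m.+1 then post_corner u0 m else drop i.+2 X) a],
       (fun n => if n is m.+1 then boundary u0 m else X) a.+1 =
       (fun n => if n is m.+1 then pre_corner u0 m else take i X) a ++
       [:: (fun n => if n is m.+1 then light u0 m else nth x0 X i.+1) a,
           (fun n => if n is m.+1 then heavy u0 m else nth x0 X i) a
         & (fun n => if n is m.+1 then post_corner u0 m else drop i.+2 X) a]
     & (((fun n => if n is m.+1 then light u0 m else nth x0 X i.+1) a).1 <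
        ((fun n => if n is m.+1 then heavy u0 m else nth x0 X i) a).1)%N].
  case=> [|a] ha; last exact: run_step.
  by split=> //=; rewrite ?e0 // !nX // ltnW.
exists (@Run k (run_length u0).+1 _ _ _ _ _ uX step) => //=; split=> //.
rewrite /run_tiles /mkseq /= eT -[1%N]addn0 iotaDl -map_comp; congr cons.
rewrite /corner_tile /run_tile /= /vsum /path_vertex /corner_type !nX ?(ltnW hi) //.
by rewrite -eX -map_take big_map.
Qed.

(** * Fillings *)

Lemma sum_content (R : nmodType) (f : content -> R) :
  \sum_c f c = f Empty + f Alpha + f Beta.
Proof.
rewrite (bigD1 Empty) //= (bigD1 Alpha) //= (bigD1 Beta) //= big1 ?addr0 ?addrA //.
by case.
Qed.

Section SequentialFilling.
Variables (R : comNzRingType) (I : finType) (alpha beta q : R).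
Variables (okA okB : pred I) (killA killB : rel I).
Implicit Types (K : pred I) (s : seq I) (F : {ffun I -> content}) (c : content).

(** Weight of a content in a tile, 0 when it is forbidden; dead tells whether an
    alpha or a beta of an earlier tile forces the tile to be empty. *)
Definition cell_weight (dead : bool) (t : I) c : R :=
  match c with
  | Empty => if dead then 1 else q
  | Alpha => (okA t && ~~ dead)%:R * alpha
  | Beta => (okB t && ~~ dead)%:R * beta
  end.

Definition kills c t : pred I := fun v =>
  match c with Empty => false | Alpha => killA t v | Beta => killB t v end.

Definition update K c t : pred I := fun v => K v || kills c t v.

(** Weight of a filling computed tile by tile, K being the set of tiles that
    the contents seen so far force to be empty. *)
Fixpoint scan K s F : R :=
  if s is t :: s' then cell_weight (K t) t (F t) * scan (update K (F t) t) s' F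
  else 1.

Fixpoint scan_sum K s : R :=
  if s is t :: s' then
    \sum_c cell_weight (K t) t c * scan_sum (update K c t) s'
  else 1.

Lemma eq_scan s K F F' : {in s, F =1 F'} -> scan K s F = scan K s F'.
Proof.
elim: s K => //= t s IH K h; rewrite h ?mem_head // IH //.
by move=> v vs; rewrite h // inE vs orbT.
Qed.

(** Fillings are summed over functions that are empty outside s, so that each
    partial filling of s is counted once. *)
Lemma sum_scan s K : uniq s ->
  \sum_(F : {ffun I -> content} | [forall v, (v \notin s) ==> (F v == Empty)])
     scan K s F = scan_sum K s.
Proof.
elim: s K => [|t s IH] K /=.
  move=> _; rewrite (big_pred1 [ffun=> Empty]) // => F.
  apply/forallP/eqP => [h|-> v]; last by rewrite ffunE.
  by apply/ffunP => v; rewrite ffunE; apply/eqP; exact: h v.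
case/andP=> ts us; rewrite (partition_big (fun F => F t) predT) //=.
apply: eq_bigr => c _; rewrite -IH // big_distrr /=.
(* Setting the content of t to c, and resetting it to Empty. *)
rewrite (reindex_onto (fun F => [ffun v => if v == t then c else F v])
                      (fun F => [ffun v => if v == t then Empty else F v])) /=;
                        last first.
  move=> F /andP[_ /eqP Ft]; apply/ffunP => v; rewrite !ffunE.
  by case: eqP => [->|].
apply: eq_big => [F|F _]; last first.
  rewrite ffunE eqxx; congr (_ * _); apply: eq_scan => v vs.
  by rewrite ffunE; case: eqP vs ts => // -> ->.
rewrite ffunE eqxx eqxx andbT; apply/andP/forallP => [[/forallP h /eqP eF] v|h].
  apply/implyP => vs; rewrite -eF !ffunE; case: ifP => // /negbT vt.
  by move: (h v); rewrite inE negb_or vt vs ffunE (negbTE vt).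
split.
  apply/forallP => v; rewrite inE negb_or; apply/implyP => /andP[vt vs].
  by move: (h v); rewrite ffunE (negbTE vt) vs.
apply/eqP/ffunP => v; rewrite !ffunE; case: eqP => [->|//].
by apply/esym/eqP; move: (h t); rewrite ts.
Qed.

Definition dead_in F (t : I) : bool :=
  [exists v, kills (F v) v t].

(** The set of dead tiles collected along the scan is the final one, because
    a tile is killed only by tiles that precede it. *)
Lemma scan_prod F s1 s2 :
  (forall v t, killA v t || killB v t -> (index v (s1 ++ s2) < index t (s1 ++
    s2))%N) ->
  uniq (s1 ++ s2) ->
  scan (fun t => has (fun v => kills (F v) v t) s1) s2 F
  = \prod_(t <- s2) cell_weight (dead_in F t) t (F t).
Proof.
elim: s2 s1 => [|t s2 IH] s1 ord us; first by rewrite big_nil.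
have us2 : uniq (rcons s1 t ++ s2) by rewrite cat_rcons.
have ts1 : t \notin s1.
  by move: us; rewrite cat_uniq /= => /and3P[_ /norP[]].
rewrite big_cons -(IH (rcons s1 t)) //=; last by rewrite cat_rcons.
have -> : has (fun v => kills (F v) v t) s1 = dead_in F t.
  apply/hasP/existsP => [[v _ h]|[v h]]; exists v => //.
  have := ord v t; rewrite [X in (_ < X)%N]index_cat (negbTE ts1) /= eqxx addn0.
  rewrite index_cat; case: ifP => // _ lt.
  have : (size s1 + index v (t :: s2) < size s1)%N.
    by apply: lt; move: h; rewrite /kills; case: (F v) => // ->; rewrite ?orbT.
  by rewrite ltnNge leq_addr.
congr (_ * _).
have eqK : forall s K K', K =1 K' -> scan K s F = scan K' s F.
  elim=> //= x s IHs K K' eK; rewrite eK; congr (_ * _); apply: IHs => v.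
  by rewrite /update eK.
by apply: eqK => v; rewrite /update has_rcons orbC.
Qed.

Lemma sum_filling s : uniq s -> (forall t, t \in s) ->
  (forall v t, killA v t || killB v t -> (index v s < index t s)%N) ->
  \sum_(F : {ffun I -> content}) \prod_t cell_weight (dead_in F t) t (F t)
  = scan_sum pred0 s.
Proof.
move=> us alls ord; rewrite -sum_scan //; apply: eq_big => [F|F _].
  by apply/esym/forallP => v; rewrite alls.
rewrite (@perm_big _ _ _ _ _ s) /=; last first.
  by apply: uniq_perm => //; [apply: index_enum_uniq | move=> t;
    rewrite alls mem_index_enum].
by rewrite -(@scan_prod F [::]).
Qed.

End SequentialFilling.

Section FillingsOfRun.
Variables (R : realType) (k : nat) (alpha beta q : R).
Hypothesis k_gt0 : (0 < k)%N.
Local Notation label := (letter k * nat)%type.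
Variable u : run k.
Local Notation T := (run_tiles R u).
Implicit Types (s t : seq_sub T) (X : seq label) (D : pred label).

Let okA t := (val t).2.2 == ltr_e.
Let okB t := (val t).2.1 == ltr_d.

(** Forbidden fillings have weight 0, so the sum can be taken over all
    functions. *)
Lemma sum_fil :
  \sum_(F in fil T) \prod_t tile_weight alpha beta q F t
  = \sum_(F : {ffun seq_sub T -> content})
      \prod_t cell_weight alpha beta q okA okB
                (dead_in (@above R k T) (@left_of R k T) F t) t (F t).
Proof.
have deadE (F : {ffun seq_sub T -> content}) t :
    dead_in (@above R k T) (@left_of R k T) F t = alpha_below F t || beta_right F t.
  apply/existsP/orP => [[v]|].
    rewrite /kills; case e : (F v) => // h; [left|right]; apply/existsP; exists v;
    by rewrite e h.
  by case=> /existsP[v /andP[/eqP e h]]; exists v; rewrite /kills e.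
rewrite big_mkcond /=; apply: eq_bigr => F _; case: ifPn.
  rewrite inE => /forallP h; apply: eq_bigr => t _; rewrite deadE.
  move: (h t); rewrite /tile_weight /cell_weight /allowed /okA /okB.
  case: (F t) => // /andP[-> /implyP]; case: (_ || _) => /= hh.
  - by have := hh isT.
  - by rewrite mul1r.
  - by have := hh isT.
  - by rewrite mul1r.
rewrite inE negb_forall => /existsP[t ht]; rewrite (bigD1 t) //= deadE.
rewrite -[LHS](mul0r (\prod_(i | i != t) cell_weight alpha beta q okA okB
   (dead_in (@above R k T) (@left_of R k T) F i) i (F i))); congr (_ * _).
move: ht; rewrite /cell_weight /allowed /okA /okB.
by case: (F t) => /=; case: (_ || _); case: ((val t).2.2 == ltr_e);
  case: ((val t).2.1 == ltr_d) => //= _; rewrite mul0r.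
Qed.

(** The word that remains when the letters carrying dead strips are erased. *)
Definition alive D X : seq (letter k) := [seq x.1 | x <- X & ~~ D x].

Local Notation value := (word_weight alpha beta q).
Local Notation scans := (scan_sum alpha beta q okA okB (@above R k T) (@left_of R k
  T)).

Lemma alive_cat D X Y : alive D (X ++ Y) = alive D X ++ alive D Y.
Proof. by rewrite /alive filter_cat map_cat. Qed.

Lemma alive_cons D x X : alive D (x :: X)
  = if D x then alive D X else x.1 :: alive D X.
Proof. by rewrite /alive /=; case: (D x). Qed.

Lemma alive_add D l X : l \notin X -> alive (predU D (pred1 l)) X = alive D X.
Proof.
move=> lX; congr map; apply: eq_in_filter => x xX /=.
by case: eqP lX => [<-|_]; rewrite ?xX ?orbF.
Qed.

(** The main induction, backwards over the steps of the run: D is the set of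
    labels of dead strips, and the tiles of steps a, ..., a + m - 1 are still to
    be filled. A tile in a dead strip has weight 1, and its exchange does not
    change the word of the living letters. A tile in two living strips is the
    corner of two living letters that are adjacent among the living ones, and the
    contents empty, alpha and beta give the three terms of the corner relation.
    At the end the word of the living letters is sorted. *)
Lemma scan_sum_word_weight m a (s : seq (seq_sub T)) (K : pred (seq_sub T)) D :
  sorted (fun a b : letter k => (a <= b)%N) (unzip1 (boundary u (run_length u))) ->
  (a + m = run_length u)%N -> map (@tile_step R k u) s = iota a m ->
  {in s, forall t, K t = D (heavy u (tile_step t)) || D (light u (tile_step t))} ->
  let w := alive D (boundary u a) in
  scans K s * alpha ^+ count_mem ltr_d w * beta ^+ count_mem ltr_e w = value w.
Proof.
move=> srt; elim: m a s K D => [|m IH] a s K D am.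
  case: s => // _ _ w /=; rewrite mul1r word_weight_sorted //.
  have ea : a = run_length u by rewrite -am addn0.
  rewrite /w ea /alive.
  rewrite sorted_map; have := srt; rewrite sorted_map => srt'.
  by apply: sorted_filter srt' => x y z; apply: leq_trans.
case: s => // t s /= [et es] hK.
have ha : (a < run_length u)%N by rewrite -am -addSnnS leq_addr.
have am' : (a.+1 + m = run_length u)%N by rewrite addSnnS.
have [a1 a2 a3] := run_step ha.
have uA := boundary_uniq (ltnW ha).
have hs v : v \in s -> (a < tile_step v < run_length u)%N.
  by move=> vs; have := map_f (@tile_step R k u) vs; rewrite es mem_iota am'.
have hKs : {in s, forall t, K t
  = D (heavy u (tile_step t)) || D (light u (tile_step t))}.
  by move=> v vs; rewrite hK // inE vs orbT.
have et2 : (val t).2 = ((heavy u a).1, (light u a).1) by rewrite -run_tile_step et.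
move: a1 a2 a3 uA; set P := pre_corner u a; set S := post_corner u a;
  set B := heavy u a; set C := light u a.
move=> a1 a2 a3 uA.
have [CP BP CS BS CB] : [/\ C \notin P, B \notin P, C \notin S, B \notin S & C != B].
  move: uA; rewrite a1 cat_uniq /= !inE !negb_or =>
    /and5P[_ /and3P[h1 h2 _] /andP[h3 h4] h5 _].
  by split; rewrite // eq_sym.
rewrite sum_content /= hK ?mem_head // et -/B -/C /okA /okB et2 /=.
have IH0 : scans (update (@above R k T) (@left_of R k T) K Empty t) s *
     alpha ^+ count_mem ltr_d (alive D (boundary u a.+1)) *
     beta ^+ count_mem ltr_e (alive D (boundary u a.+1))
       = value (alive D (boundary u a.+1)).
  by apply: IH => // v vs; rewrite /update /= orbF hKs.
have permD : perm_eq (alive D (boundary u a.+1)) (alive D (boundary u a)).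
  apply/perm_map/perm_filter; rewrite a1 a2 perm_cat2l.
  by apply/permP => p /=; rewrite addnCA.
rewrite !(permP permD) in IH0.
have [dead|] := boolP (D B || D C).
  rewrite !andbF !mul0r !addr0 mul1r IH0 a1 a2 !alive_cat !alive_cons.
  by case/orP: dead => ->; case: (D _).
rewrite negb_or => /andP[nB nC]; rewrite !andbT.
have eA : alive D (boundary u a) = alive D P ++ [:: B.1, C.1 & alive D S].
  by rewrite a1 alive_cat !alive_cons (negbTE nB) (negbTE nC).
have eA' : alive D (boundary u a.+1) = alive D P ++ [:: C.1, B.1 & alive D S].
  by rewrite a2 alive_cat !alive_cons (negbTE nB) (negbTE nC).
have Bne : B.1 != ltr_e by apply: heavy_neq_e.
have Cnd : C.1 != ltr_d by apply: light_neq_d.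
(* An alpha kills the strip of C; erasing C costs a factor beta. *)
have caseA : C.1 = ltr_e ->
   scans (update (@above R k T) (@left_of R k T) K Alpha t) s * alpha *
   alpha ^+ count_mem ltr_d (alive D (boundary u a)) *
   beta ^+ count_mem ltr_e (alive D (boundary u a))
   = alpha * beta * value (alive D P ++ B.1 :: alive D S).
  move=> eC; have <- : alive (predU D (pred1 C)) (boundary u a.+1)
    = alive D P ++ B.1 :: alive D S.
    rewrite a2 alive_cat !alive_cons /= eqxx orbT (negbTE nB) /= eq_sym (negbTE CB).
    by rewrite !alive_add.
  rewrite -(IH a.+1 s (update (@above R k T) (@left_of R k T) K Alpha t)) //;
    last first.
    move=> v vs; rewrite /update /= hKs // aboveE // /e_strip et -/C eC eqxx /=.
    have /andP[av vl] := hs v vs; rewrite av andbT.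
    have -> : (heavy u (tile_step v) == C) = false.
      by apply: contraNF (heavy_neq_e vl) => /eqP ->; rewrite eC.
    rewrite orbF orbA; congr (_ || _).
    case: ifP => h; first by rewrite (inj_eq Some_inj) eq_sym.
    by apply/esym/negbTE; apply: contraFN h => /eqP ->; rewrite eC.
  rewrite eA a2 alive_cat !alive_cons /= eqxx orbT (negbTE nB) /= eq_sym (negbTE CB).
  rewrite !alive_add // !count_cat /= eC eqxx (negbTE Bne) [ltr_e == ltr_d]eq_sym
    (d_neq_e k_gt0) !add0n.
  by rewrite [(_ + (true + _))%N]addnCA add1n exprS; ring.
(* A beta kills the strip of B; erasing B costs a factor alpha. *)
have caseB : B.1 = ltr_d ->
   scans (update (@above R k T) (@left_of R k T) K Beta t) s * beta *
   alpha ^+ count_mem ltr_d (alive D (boundary u a)) *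
   beta ^+ count_mem ltr_e (alive D (boundary u a))
   = alpha * beta * value (alive D P ++ C.1 :: alive D S).
  move=> eB; have <- : alive (predU D (pred1 B)) (boundary u a.+1)
    = alive D P ++ C.1 :: alive D S.
    rewrite a2 alive_cat !alive_cons /= eqxx orbT (negbTE nC) /= (negbTE CB).
    by rewrite !alive_add.
  rewrite -(IH a.+1 s (update (@above R k T) (@left_of R k T) K Beta t)) //;
    last first.
    move=> v vs; rewrite /update /= hKs // left_ofE // /d_strip et -/B eB eqxx /=.
    have /andP[av vl] := hs v vs; rewrite av andbT.
    have -> : (light u (tile_step v) == B) = false.
      by apply: contraNF (light_neq_d vl) => /eqP ->; rewrite eB.
    rewrite orbF orbAC; congr (_ || _); congr (_ || _).
    case: ifP => h; first by rewrite (inj_eq Some_inj) eq_sym.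
    by apply/esym/negbTE; apply: contraFN h => /eqP ->; rewrite eB.
  rewrite eA a2 alive_cat !alive_cons /= eqxx orbT (negbTE nC) /= (negbTE CB).
  rewrite !alive_add // !count_cat /= eB eqxx (negbTE Cnd) (d_neq_e k_gt0) !add0n.
  by rewrite [(_ + (true + _))%N]addnCA add1n exprS; ring.
rewrite eA word_weight_corner // -eA -eA' -IH0.
have -> x y z v : (x + y + z) * v = x * v + y * v + z * v :> R by ring.
have -> x y z v : (x + y + z) * v = x * v + y * v + z * v :> R by ring.
congr (_ + _ + _); first by ring.
  have [eC|_] := eqVneq C.1 ltr_e; last by rewrite !mul0r.
  by rewrite !mul1r -caseA // [alpha * scans _ _]mulrC.
have [eB|_] := eqVneq B.1 ltr_d; last by rewrite !mul0r.
by rewrite !mul1r -caseB // [beta * scans _ _]mulrC.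
Qed.

Lemma sum_wt_run :
  sorted (fun a b : letter k => (a <= b)%N) (unzip1 (boundary u (run_length u))) ->
  \sum_(F in fil T) wt alpha beta q (unzip1 (boundary u 0)) F
    = value (unzip1 (boundary u 0)).
Proof.
move=> srt; rewrite /wt -!big_distrl /= sum_fil.
pose s : seq (seq_sub T) := pmap insub T.
have vs : map val s = T.
  rewrite /s pmap_filter; last exact: insubK.
  by apply/all_filterP/allP => x xT /=; rewrite insubT.
have us : uniq s by apply: (@map_uniq _ _ val); rewrite vs run_tiles_uniq.
have alls t : t \in s by rewrite -(mem_map val_inj) vs (valP t).
have idx t : index t s = tile_step t by rewrite -(index_map val_inj) vs.
rewrite (@sum_filling _ _ _ _ _ _ _ _ _ s) //; last first.
  by move=> v t; rewrite !idx aboveE // left_ofE // => /orP[] /and3P[].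
have : map (@tile_step R k u) s = iota 0 (run_length u).
  have -> : run_length u = size s by rewrite -(size_map val) vs size_mkseq.
  rewrite -(eq_map idx).
  apply: (@eq_from_nth _ 0%N); rewrite ?size_map ?size_iota // => i hi.
  case: s vs us alls idx hi => // t0 s0 _ us _ _ hi.
  by rewrite (nth_map t0) // nth_iota // index_uniq.
move=> h; have := @scan_sum_word_weight (run_length u) 0 s pred0 pred0 srt (add0n
  _) h (fun _ _ => erefl).
have -> : alive pred0 (boundary u 0) = unzip1 (boundary u 0).
  by rewrite /alive filter_predT.
exact.
Qed.

End FillingsOfRun.

Lemma sum_wt_tiling (R : realType) (k : nat) (alpha beta q : R)
    (w : seq (letter k)) (T : seq (tile R k)) : (0 < k)%N ->
  maximal_tiling w T ->
  \sum_(F in fil T) wt alpha beta q w F = word_weight alpha beta q w.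
Proof.
by move=> k_gt0 /(maximal_tiling_run) [u [<- srt ->]]; apply: sum_wt_run.
Qed.

(* T X is any result of the maximal tiling procedure for the state X, with an
   arbitrary choice among corners of the same maximal type at each step. *)
Theorem theorem6p7 (R : realType) (k n : nat) (r : nat -> nat)
    (alpha beta q : R) (T : omega k n r -> seq (tile R k)) (W : omega k n r) :
  (0 < k)%N ->
  0 <= q <= 1 -> 0 < alpha -> 0 < beta ->
  (forall X : omega k n r, outgoing alpha beta q X <= 1) ->
  (forall X : omega k n r, maximal_tiling (word_of X) (T X)) ->
  exists p : {ffun omega k n r -> R},
    [/\ stationary alpha beta q p,
        (forall p' : {ffun omega k n r -> R},
           stationary alpha beta q p' -> p' = p) &
    p W =
      (\sum_(X : omega k n r)
         \sum_(F in fil (T X)) wt alpha beta q (word_of X) F)^-1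
      * \sum_(F in fil (T W)) wt alpha beta q (word_of W) F].
Proof.
move=> k_gt0 /andP[q_ge0 _] alpha_gt0 beta_gt0 out tilT.
pose f X := \sum_(F in fil (T X)) wt alpha beta q (word_of X) F.
have fE X : f X = word_weight alpha beta q (word_of X) by apply: sum_wt_tiling.
have f_ge0 X : 0 <= f X.
  apply: sumr_ge0 => F _; rewrite /wt !mulr_ge0 ?exprn_ge0 ?(ltW alpha_gt0) ?(ltW beta_gt0) //.
  apply: prodr_ge0 => t _; rewrite /tile_weight.
  by case: (F t); rewrite ?(ltW alpha_gt0) ?(ltW beta_gt0) //; case: ifP.
(* For q = 0 the weight of the sorted word is still positive. *)
have Z_gt0 : 0 < \sum_X f X.
  have [|S eS] := @in_omegaP k n r (northwest_word (word_of W)).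
    by apply: in_omega_perm (word_of_in W); rewrite perm_sym perm_northwest_word.
  rewrite (bigD1 S) //= ltr_pwDl ?sumr_ge0 // fE eS word_weight_sorted //.
    by rewrite mulr_gt0 // exprn_gt0.
  exact: sorted_northwest_word.
exists [ffun X => (\sum_X f X)^-1 * f X].
have stat : stationary alpha beta q [ffun X => (\sum_X f X)^-1 * f X].
  split=> [X||Y].
  - by rewrite ffunE mulr_ge0 // invr_ge0 ltW.
  - under eq_bigr do rewrite ffunE.
    by rewrite -big_distrr /= mulVf // gt_eqF.
  - rewrite ffunE -[in RHS](@balance_stationary R k n r alpha beta q f).
      by rewrite big_distrr /=; apply: eq_bigr => X _; rewrite ffunE mulrA.
    move=> {}Y; rewrite fE -balance //; by apply: eq_bigr => X _; rewrite fE.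
split=> //; last by rewrite ffunE.
by move=> p' statp'; apply: (stationary_unique k_gt0 q_ge0 alpha_gt0 beta_gt0 out).
Qed.
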